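(* Let $(R,\mathfrak m)$ be a $1$-dimensional Cohen–Macaulay local ring with infinite residue field and with a canonical ideal $C$. Then $\mathrm{cdeg}(R)=r(R)-1$ if and only if $R$ is an almost Gorenstein ring.
   Context: A canonical ideal is an ideal isomorphic to a canonical module. In dimension one, $\mathrm{cdeg}(R)=\mathrm e_0(C)-\lambda(R/C)$, where $\mathrm e_0(C)$ is the Hilbert–Samuel multiplicity of $R$ with respect to $C$ (equal to $0$ if $C=R$) and $\lambda$ is length; this is independent of $C$. $r(R)$ is the Cohen–Macaulay type. A Cohen–Macaulay local ring $R$ with canonical module $\omega$ is almost Gorenstein if there is an exact sequence of $R$-modules $0\to R\to\omega\to X\to 0$ with $\nu(X)=\mathrm e_0(X)$, where $\nu$ is the minimal number of generators and $\mathrm e_0(X)=\mathrm e_0(\mathfrak m,X)$ is the multiplicity with respect to $\mathfrak m$ (both are $0$ if $X=0$). *)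

(* Defs.v *)
From HB Require Import structures.
From mathcomp Require Import all_boot all_order all_algebra.
From mathcomp Require Import boolp classical_sets functions cardinality.

Set Implicit Arguments.
Unset Strict Implicit.
Unset Printing Implicit Defensive.

Import GRing.Theory.

Local Open Scope classical_set_scope.
Local Open Scope ring_scope.

(* Greatest element of a set of natural numbers; 0 if there is none. *)
Definition nat_max (P : set nat) : nat :=
  xget 0%N [set n | P n /\ forall k, P k -> (k <= n)%N].

(* Least element of a set of natural numbers; 0 if there is none. *)
Definition nat_min (P : set nat) : nat :=
  xget 0%N [set n | P n /\ forall k, P k -> (n <= k)%N].

Section Modules.
Variable R : comNzRingType.

Section OneModule.
Variable M : lmodType R.

Definition submodule (N : set M) : Prop := GRing.submod_closed [in N].

Definition span (S : set M) : set M := smallest submodule S.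

(* The submodule J N, where J generates an ideal (J need not be closed under
   the ring operations itself). *)
Definition smul (J : set R) (N : set M) : set M :=
  span [set a *: v | a in J & v in N].

(* The submodule I^n M. *)
Definition power_mul (I : set R) (n : nat) : set M :=
  iter n (smul I) [set: M].

Definition generated_by (n : nat) (N : set M) : Prop :=
  exists v : 'I_n -> M, span (range v) = N.

Definition finitely_generated (N : set M) : Prop :=
  exists n, generated_by n N.

(* For submodules A of B, lengths of strict chains of submodules from A to B;
   [length_is A B l] says that the module B / A has finite length l. *)
Definition chain_between (A B : set M) (n : nat) : Prop :=
  exists N : nat -> set M,
    (forall i, (i <= n)%N -> [/\ submodule (N i), A `<=` N i & N i `<=` B]) /\
    (forall i, (i < n)%N -> N i `<` N i.+1).

Definition length_is (A B : set M) (l : nat) : Prop :=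
  chain_between A B l /\ forall k, chain_between A B k -> (k <= l)%N.

Definition annihilator : set R := [set a | forall v : M, a *: v = 0].

End OneModule.

(* An ideal of R is a submodule of the regular module R^o. *)
Definition ideal (I : set R) : Prop := @submodule R^o I.

Definition prime_ideal (P : set R) : Prop :=
  [/\ ideal P, ~ P 1 & forall a b, P (a * b) -> P a \/ P b].

Definition maximal_ideal (I : set R) : Prop :=
  [/\ ideal I, ~ I 1 & forall J, ideal J -> I `<=` J -> ~ J 1 -> J = I].

Definition noetherian : Prop :=
  forall I : set R, ideal I -> @finitely_generated R^o I.

Definition local_ring (m : set R) : Prop :=
  maximal_ideal m /\ forall m', maximal_ideal m' -> m' = m.

(* The residue field R / m is infinite; its elements are the cosets a + m. *)
Definition infinite_residue_field (m : set R) : Prop :=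
  infinite_set (range (fun a : R => [set b | m (b - a)])).

(* The length of R / I. *)
Definition colength (I : set R) : nat :=
  xget 0%N [set l | @length_is R^o I [set: R^o] l].

(* dim M = dim R / ann M, for nonzero M. *)
Definition krull_dim (M : lmodType R) : nat :=
  nat_max [set n | exists P : nat -> set R,
    (forall i, (i <= n)%N -> prime_ideal (P i) /\ annihilator M `<=` P i) /\
    (forall i, (i < n)%N -> P i `<` P i.+1)].

(* s is an M-regular sequence, (x_1, ..., x_n) M being [smul] of the set of
   the x_i and of M. *)
Definition regular_sequence (M : lmodType R) (s : seq R) : Prop :=
  (forall i, (i < size s)%N -> forall v : M,
     smul [set` take i s] [set: M] (s`_i *: v) ->
     smul [set` take i s] [set: M] v) /\
  smul [set` s] [set: M] <> [set: M].

Definition depth (m : set R) (M : lmodType R) : nat :=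
  nat_max [set n | exists s : seq R,
    [/\ size s = n, [set` s] `<=` m & regular_sequence M s]].

Definition cohen_macaulay_local (m : set R) : Prop :=
  [/\ noetherian, local_ring m & depth m R^o = krull_dim R^o].

(* The minimal number of generators of M. *)
Definition nu (M : lmodType R) : nat :=
  nat_min [set n | generated_by n [set: M]].

(* The Hilbert-Samuel multiplicity e_0(I, M): d! times the coefficient of
   degree d = dim M of the polynomial which agrees with n |-> length (M / I^n M)
   for large n. It vanishes for M = 0, and also for I = R if dim M > 0. *)
Definition multiplicity (I : set R) (M : lmodType R) : rat :=
  xget 0 [set e | exists p : {poly rat},
    (exists n0, forall n, (n0 <= n)%N -> exists l,
       length_is (@power_mul M I n) [set: M] l /\ p.[n%:R] = l%:R) /\
    e = ((krull_dim M)`!)%:R * p`_(krull_dim M)].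

Definition exact_at (U V W : lmodType R) (f : U -> V) (g : V -> W) : Prop :=
  range f = [set v | g v = 0].

Definition projective_module (P : lmodType R) : Prop :=
  forall (U V : lmodType R) (g : {linear U -> V}) (h : {linear P -> V}),
    range g = [set: V] -> exists h' : {linear P -> U}, forall x, g (h' x) = h x.

Definition injective_module (E : lmodType R) : Prop :=
  forall (U V : lmodType R) (g : {linear U -> V}) (h : {linear U -> E}),
    injective g -> exists h' : {linear V -> E}, forall x, h' (g x) = h x.

(* ... -> P 2 -> P 1 -> P 0 -> K -> 0 *)
Record projective_resolution (K : lmodType R) := ProjectiveResolution {
  pr_mod : nat -> lmodType R;
  pr_diff : forall n, {linear pr_mod n.+1 -> pr_mod n};
  pr_aug : {linear pr_mod 0 -> K};
  pr_projective : forall n, projective_module (pr_mod n);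
  pr_surj : range pr_aug = [set: K];
  pr_exact0 : exact_at (pr_diff 0) pr_aug;
  pr_exactS : forall n, exact_at (pr_diff n.+1) (pr_diff n) }.

(* 0 -> M -> E 0 -> E 1 -> E 2 -> ... *)
Record injective_resolution (M : lmodType R) := InjectiveResolution {
  ir_mod : nat -> lmodType R;
  ir_diff : forall n, {linear ir_mod n -> ir_mod n.+1};
  ir_aug : {linear M -> ir_mod 0};
  ir_injective : forall n, injective_module (ir_mod n);
  ir_inj : injective ir_aug;
  ir_exact0 : exact_at ir_aug (ir_diff 0);
  ir_exactS : forall n, exact_at (ir_diff n) (ir_diff n.+1) }.

Definition finite_injective_dimension (M : lmodType R) : Prop :=
  exists (E : injective_resolution M) (n : nat),
    forall i, (n <= i)%N -> forall x : ir_mod E i, x = 0.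

(* Cocycles and coboundaries of the complex Hom(P, M), inside the R-module of
   all functions from P n to M. *)
Definition ext_cocycles (K M : lmodType R) (P : projective_resolution K)
    (n : nat) : set (pr_mod P n -> M) :=
  [set f | linear f /\ forall y, f (pr_diff P n y) = 0].

Definition ext_coboundaries (K M : lmodType R) (P : projective_resolution K)
    (n : nat) : set (pr_mod P n -> M) :=
  match n return set (pr_mod P n -> M) with
  | 0 => [set 0]
  | k.+1 => [set f | exists g : {linear pr_mod P k -> M},
                       f = fun y => g (pr_diff P k y)]
  end.

Definition ext_length_is (n : nat) (K M : lmodType R) (l : nat) : Prop :=
  exists P : projective_resolution K,
    length_is (@ext_coboundaries K M P n) (@ext_cocycles K M P n) l.

(* K is (isomorphic to) the cyclic module R / I. *)
Definition is_cyclic_quotient (I : set R) (K : lmodType R) : Prop :=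
  exists q : {linear R^o -> K},
    range q = [set: K] /\ forall a : R, q a = 0 <-> I a.

(* The type r(M), i.e. the dimension over R / m (equivalently, the length) of
   Ext^t(R / m, M), where t = depth M. *)
Definition cm_type (m : set R) (M : lmodType R) : nat :=
  xget 0%N [set l | exists2 K : lmodType R,
    is_cyclic_quotient m K & ext_length_is (depth m M) K M l].

Definition maximal_cohen_macaulay (m : set R) (M : lmodType R) : Prop :=
  [/\ finitely_generated [set: M], exists v : M, v <> 0,
      depth m M = krull_dim M & krull_dim M = krull_dim R^o].

Definition canonical_module (m : set R) (W : lmodType R) : Prop :=
  [/\ maximal_cohen_macaulay m W, cm_type m W = 1%N &
      finite_injective_dimension W].

Definition canonical_ideal (m C : set R) : Prop :=
  ideal C /\
  exists W : lmodType R, canonical_module m W /\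
    exists f : {linear W -> R^o}, injective f /\ range f = C.

(* The canonical degree of a one-dimensional Cohen-Macaulay local ring,
   computed from the canonical ideal C. *)
Definition cdeg (C : set R) : rat :=
  multiplicity C R^o - (colength C)%:R.

Definition almost_gorenstein (m : set R) : Prop :=
  exists W X : lmodType R, exists (f : {linear R^o -> W}) (g : {linear W -> X}),
    [/\ canonical_module m W,
        [/\ injective f, exact_at f g & range g = [set: X]] &
        (nu X)%:R = multiplicity m X].

End Modules.

(* Main.v *)
Require Import Defs.
From HB Require Import structures.
From mathcomp Require Import all_boot all_order all_algebra finmap ring zify.
From mathcomp Require Import boolp classical_sets functions cardinality.

Set Implicit Arguments.
Unset Strict Implicit.
Unset Printing Implicit Defensive.

Import GRing.Theory.
Local Open Scope classical_set_scope.
Local Open Scope ring_scope.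
Local Notation span := Defs.span.

(** Let [z] in [C] generate a minimal reduction: [C^(n+1) = z C^n] for large [n]. The length of
    [R / C^n] then grows by the length of [R / zR] at each step, so [e_0 (C)] is the length of
    [R / zR] and [cdeg R] is the length of [C / zR] ([cdeg_reduction]). On the other hand, the
    type [r] of [R] is the length of [C / mC] ([type_eq_generators]). Since [zm] lies in [mC] and
    has colength [cdeg R + 1] in [C], the equality [cdeg R = r - 1] means that [mC = zm]
    ([cdeg_eq_type]).

    If [mC = zm], then [X = C / zR] is killed by [m], so that its number of generators and its
    multiplicity are both its length, and [0 -> R -> C -> X -> 0] shows that [R] is almost
    Gorenstein. Conversely let [0 -> R -> W -> X -> 0] be given. Then [X] has finite length, its
    multiplicity is that length, and a module with as many generators as its length is killed by
    [m]. Transported to [C], this gives a regular [c] in [C] with [mC] inside [cR]; after a change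
    of [c], [mC = cm] ([smul_m_principal]). Hence [m C^n = c^n m] for all [n], and the reduction
    equation for [z] yields [cm = zm], which is [mC = zm] ([smul_m_reduction]).

    The theory of canonical modules that this needs is obtained as follows.
    - [Ext^1 (R/m, M)] is [(yM : m) / yM] for any [M]-regular [y] in [m], whatever projective
      resolution computes it ([ext1_length_is]). So type one means that these socles have
      length one.
    - Type one bounds the jumps of [J |-> (yN :_N J)] and of [K |-> (yN :_R K)] along simple steps
      by one ([perp_len], [coperp_len]). When [N] is an ideal that contains a regular element,
      [N / yN] and [R / yR] have the same length, so all the jumps are equal to one; this is the
      duality [C : (C : I) = I] in terms of lengths, and it contains [r = len (C / mC)] and the
      uniqueness of the canonical ideal ([type_one_ideal_unique]).
    - That an ideal isomorphic to a canonical module contains a regular element is where finite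
      injective dimension enters: it makes the same jumps strict ([residual_strict]), so that
      [C / x^n C] is at least as long as [R / x^n R], and then [C] contains a power of [x] by a
      growth argument ([cofinal]). The growth argument with the reversed inequality, which comes
      from type one, turns the abstract module [W] into a canonical ideal
      ([canonical_over_ring]).
    - The reduction exists by an argument of Eakin and Sathaye ([covering_element]), the infinite
      residue field being needed to avoid the roots of finitely many determinants. *)

(** * Submodules *)

Section Submodules.
Variables (R : comNzRingType) (M : lmodType R).
Implicit Types (A B C N : set M) (a b r : R) (u v w : M).

Lemma submoduleP N : submodule N <->
  N 0 /\ forall a u v, N u -> N v -> N (a *: u + v).
Proof.
split=> [[/set_mem N0 cl]|[N0 cl]].
  by split=> // a u v Nu Nv; apply/set_mem/cl; exact/mem_set.
by split=> [|a u v /set_mem Nu /set_mem Nv]; apply/mem_set => //; exact: cl.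
Qed.

Lemma submod0 N : submodule N -> N 0.
Proof. by case/submoduleP. Qed.

Lemma submodZ N a u : submodule N -> N u -> N (a *: u).
Proof. by case/submoduleP => N0 cl Nu; rewrite -[a *: u]addr0; exact: cl. Qed.

Lemma submodD N u v : submodule N -> N u -> N v -> N (u + v).
Proof. by case/submoduleP => N0 cl Nu Nv; rewrite -[u]scale1r; exact: cl. Qed.

Lemma submodN N u : submodule N -> N u -> N (- u).
Proof. by move=> sN Nu; rewrite -scaleN1r; exact: submodZ. Qed.

Lemma submodB N u v : submodule N -> N u -> N v -> N (u - v).
Proof. by move=> sN Nu Nv; apply: submodD => //; exact: submodN. Qed.

Lemma submodDr N u v : submodule N -> N u -> N (u + v) -> N v.
Proof. by move=> sN Nu /(submodB sN) /(_ Nu); rewrite addrAC subrr add0r. Qed.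

Lemma submod_sum N (I : Type) (s : seq I) (F : I -> M) :
  submodule N -> (forall i, N (F i)) -> N (\sum_(i <- s) F i).
Proof.
move=> sN NF; elim/big_rec: _ => [|i u _ Nu]; first exact: submod0.
exact: submodD.
Qed.

Lemma submodT : submodule [set: M].
Proof. by apply/submoduleP. Qed.

Lemma submod_zero : submodule [set (0 : M)].
Proof. by apply/submoduleP; split=> //= a u v -> ->; rewrite scaler0 addr0. Qed.

Lemma submodI A B : submodule A -> submodule B -> submodule (A `&` B).
Proof.
move=> sA sB; apply/submoduleP; split; first by split; exact: submod0.
by move=> a u v [Au Bu] [Av Bv]; split; apply: submodD => //; exact: submodZ.
Qed.

Lemma span_incl (S : set M) : S `<=` span S.
Proof. exact: sub_gen_smallest. Qed.

Lemma span_min (S N : set M) : submodule N -> S `<=` N -> span S `<=` N.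
Proof. by move=> sN SN; apply: smallest_sub. Qed.

Lemma submod_span (S : set M) : submodule (span S).
Proof.
apply/submoduleP; split=> [N [sN _]|a u v Su Sv N [sN SN]]; first exact: submod0.
by apply: submodD => //; [apply: submodZ|]; move=> //; [exact: Su|exact: Sv].
Qed.

Definition sums A B : set M := [set w | exists u v, [/\ A u, B v & w = u + v]].

Lemma submod_sums A B : submodule A -> submodule B -> submodule (sums A B).
Proof.
move=> sA sB; apply/submoduleP; split.
  by exists 0, 0; rewrite addr0; split=> //; exact: submod0.
move=> a _ _ [u [v [Au Bv ->]]] [u' [v' [Au' Bv' ->]]].
exists (a *: u + u'), (a *: v + v'); split; last by rewrite scalerDr addrACA.
  by apply: submodD => //; exact: submodZ.
by apply: submodD => //; exact: submodZ.
Qed.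

Lemma sums_left A B : submodule B -> A `<=` sums A B.
Proof. by move=> sB u Au; exists u, 0; rewrite addr0; split=> //; exact: submod0. Qed.

Lemma sums_right A B : submodule A -> B `<=` sums A B.
Proof. by move=> sA u Bu; exists 0, u; rewrite add0r; split=> //; exact: submod0. Qed.

Lemma sums_min A B N : submodule N -> A `<=` N -> B `<=` N -> sums A B `<=` N.
Proof. by move=> sN AN BN _ [u [v [/AN Nu /BN Nv ->]]]; exact: submodD. Qed.

Definition line u : set M := [set w | exists r, w = r *: u].

Lemma submod_line u : submodule (line u).
Proof.
apply/submoduleP; split; first by exists 0; rewrite scale0r.
by move=> a _ _ [r ->] [r' ->]; exists (a * r + r'); rewrite scalerDl scalerA.
Qed.

Lemma line_self u : line u u.
Proof. by exists 1; rewrite scale1r. Qed.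

Lemma line_min u N : submodule N -> N u -> line u `<=` N.
Proof. by move=> sN Nu _ [r ->]; exact: submodZ. Qed.

Definition adjoin A u : set M := sums A (line u).

Lemma submod_adjoin A u : submodule A -> submodule (adjoin A u).
Proof. by move=> sA; apply: submod_sums => //; exact: submod_line. Qed.

Lemma sub_adjoin A u : A `<=` adjoin A u.
Proof. by apply: sums_left; exact: submod_line. Qed.

Lemma adjoin_self A u : submodule A -> adjoin A u u.
Proof. by move=> sA; apply: sums_right => //; exact: line_self. Qed.

Lemma adjoin_min A u N : submodule N -> A `<=` N -> N u -> adjoin A u `<=` N.
Proof. by move=> sN AN Nu; apply: sums_min => //; exact: line_min. Qed.

Definition homothety a N : set M := [set w | exists2 v, N v & w = a *: v].

Lemma submod_homothety a N : submodule N -> submodule (homothety a N).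
Proof.
move=> sN; apply/submoduleP; split; first by exists 0; [exact: submod0|rewrite scaler0].
move=> b _ _ [u Nu ->] [v Nv ->]; exists (b *: u + v).
  by apply: submodD => //; exact: submodZ.
by rewrite scalerDr !scalerA mulrC.
Qed.

Lemma homothety_sub a N : submodule N -> homothety a N `<=` N.
Proof. by move=> sN _ [v Nv ->]; exact: submodZ. Qed.

Lemma homothetyS a A B : A `<=` B -> homothety a A `<=` homothety a B.
Proof. by move=> AB _ [v /AB Bv ->]; exists v. Qed.

Lemma smul_in (J : set R) N a v : J a -> N v -> smul J N (a *: v).
Proof. by move=> Ja Nv; apply: span_incl; exists a => //; exists v. Qed.

Lemma smul_min (J : set R) N A : submodule A ->
  (forall a v, J a -> N v -> A (a *: v)) -> smul J N `<=` A.
Proof. by move=> sA JNA; apply: span_min => // _ [a Ja [v Nv <-]]; exact: JNA. Qed.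

Lemma submod_smul (J : set R) N : submodule (smul J N).
Proof. exact: submod_span. Qed.

Lemma smul_sub (J : set R) N : submodule N -> smul J N `<=` N.
Proof. by move=> sN; apply: smul_min => // a v _; exact: submodZ. Qed.

Lemma smulS (J : set R) A B : A `<=` B -> smul J A `<=` smul J B.
Proof.
by move=> AB; apply: smul_min; [exact: submod_smul|move=> a v Ja /AB; exact: smul_in].
Qed.

Lemma submod_power (I : set R) n : submodule (@power_mul R M I n).
Proof. by case: n => [|n]; [exact: submodT|exact: submod_smul]. Qed.

(** Nested submodules with the same trace on [D] and the same sum with [D] are equal. It is what
    lets lengths and chain conditions be checked on a submodule and on the quotient. *)
Lemma modular_law A B D : submodule A -> submodule B -> submodule D ->
  A `<=` B -> A `&` D = B `&` D -> sums A D = sums B D -> A = B.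
Proof.
move=> sA sB sD AB eI eS; apply/seteqP; split=> // v Bv.
have: sums A D v by rewrite eS; exact: sums_left.
move=> [u [d [Au Dd vE]]].
have Bd : B d.
  have -> : d = v - u by rewrite vE addrAC subrr add0r.
  by apply: submodB => //; exact: AB.
have [Ad _] : (A `&` D) d by rewrite eI.
by rewrite vE; exact: submodD.
Qed.

End Submodules.

Lemma homothety1 (R : comNzRingType) (M : lmodType R) (N : set M) : homothety 1 N = N.
Proof.
by apply/seteqP; split=> [_ [v Nv ->]|v Nv]; [|exists v]; rewrite ?scale1r.
Qed.

Lemma homothetyA (R : comNzRingType) (M : lmodType R) (a b : R) (N : set M) :
  homothety a (homothety b N) = homothety (a * b) N.
Proof.
apply/seteqP; split=> [_ [_ [v Nv ->] ->]|_ [v Nv ->]].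
  by exists v => //; rewrite scalerA.
by exists (b *: v); [exists v|rewrite scalerA].
Qed.

(** * Lengths *)

Section Lengths.
Variables (R : comNzRingType) (M : lmodType R).
Implicit Types (A B C D N : set M).

Definition finite_length A B : Prop := exists l, length_is A B l.

(** The length of [B / A]; quotients are replaced throughout by pairs [A `<=` B] of submodules of
    one ambient module. *)
Definition len A B : nat := xget 0%N [set l | length_is A B l].

Lemma length_is_unique A B k l : length_is A B k -> length_is A B l -> k = l.
Proof. by move=> [ck mk] [cl ml]; apply/eqP; rewrite eqn_leq ml // mk. Qed.

Lemma lenE A B l : length_is A B l -> len A B = l.
Proof. by move=> lAB; apply: xget_unique => // k /length_is_unique; exact. Qed.

Lemma lenP A B : finite_length A B -> length_is A B (len A B).
Proof. by move=> [l lAB]; rewrite (lenE lAB). Qed.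

Lemma chain0 A B : submodule A -> A `<=` B -> chain_between A B 0.
Proof. by move=> sA AB; exists (fun=> A); split=> // i _; split. Qed.

Lemma chain_sub A B A' B' n : A' `<=` A -> B `<=` B' ->
  chain_between A B n -> chain_between A' B' n.
Proof.
move=> A'A BB' [N [Nb Ns]]; exists N; split=> // i /Nb [sN AN NB]; split=> //.
  exact: subset_trans AN.
exact: subset_trans BB'.
Qed.

Lemma chain_snoc A B C n : submodule C -> B `<` C ->
  chain_between A B n -> chain_between A C n.+1.
Proof.
move=> sC BC [N [Nb Ns]]; exists (fun i => if (i <= n)%N then N i else C); split=> i.
  case: (leqP i n) => [/Nb[sN AN NB] _|ni _].
    by split=> //; apply: subset_trans NB _; case: BC.
  split=> //; have [_ A0 B0] := Nb 0%N (leq0n _).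
  by apply: subset_trans A0 _; apply: subset_trans B0 _; case: BC.
rewrite ltnS => ni; rewrite ni; case: (leqP i.+1 n) => [/Ns//|nSi].
have [sN AN NB] := Nb _ ni.
case: BC => BC nCB; split; first exact: subset_trans BC.
by move=> CN; apply: nCB; exact: subset_trans NB.
Qed.

Lemma chain_cat A B C p q : chain_between A B p -> chain_between B C q ->
  chain_between A C (p + q).
Proof.
move=> cAB [N [Nb Ns]].
have cN i : (i <= q)%N -> chain_between A (N i) (p + i).
  elim: i => [|i IH] iq; have [sN BN NC] := Nb _ iq.
    by rewrite addn0; apply: chain_sub cAB.
  by rewrite addnS; apply: chain_snoc (IH (ltnW iq)) => //; exact: Ns.
by apply: chain_sub (cN q (leqnn _)) => //; case: (Nb q (leqnn _)).
Qed.

(** The modular law turns a chain into one below and one above [B]: at each step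
    the trace on [B] or the sum with [B] must grow. *)
Lemma chain_split A B C n : submodule B -> A `<=` B -> B `<=` C ->
  submodule C -> submodule A ->
  chain_between A C n -> exists p q,
  [/\ (n <= p + q)%N, chain_between A B p & chain_between B C q].
Proof.
move=> sB AB BC sC sA [N [Nb Ns]].
suff [p [q [npq cp cq]]] : exists p q, [/\ (n <= p + q)%N,
    chain_between A (N n `&` B) p & chain_between B (sums (N n) B) q].
  have [sN AN NC] := Nb n (leqnn _).
  exists p, q; split=> //; first by apply: chain_sub cp => // v [].
  by apply: chain_sub cq => //; exact: sums_min.
elim: n Nb Ns => [|n IH] Nb Ns.
  have [sN AN NC] := Nb 0%N (leqnn _).
  exists 0%N, 0%N; split=> //; apply: chain0 => //; first by move=> v Av; split; [exact: AN|exact: AB].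
  exact: sums_right.
have [p [q [npq cp cq]]] := IH (fun i h => Nb i (leqW h)) (fun i h => Ns i (leqW h)).
have [sN AN NC] := Nb n (leqnSn _); have [sN' AN' NC'] := Nb n.+1 (leqnn _).
have [NN' nN'N] : N n `<` N n.+1 by apply: Ns.
have [eI|nI] := pselect (N n `&` B = N n.+1 `&` B).
  have nS : sums (N n) B <> sums (N n.+1) B.
    by move=> eS; apply: nN'N; rewrite -(modular_law sN sN' sB NN' eI eS).
  exists p, q.+1; split; first by rewrite addnS.
    by rewrite -eI.
  apply: chain_snoc cq; first exact: submod_sums.
  split; first by apply: sums_min; [exact: submod_sums|apply: subset_trans NN' (sums_left _)|
     exact: sums_right].
  move=> h; apply: nS; apply/seteqP; split=> //.
  by apply: sums_min; [exact: submod_sums|apply: subset_trans NN' (sums_left _)|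
     exact: sums_right].
have SS : sums (N n) B `<=` sums (N n.+1) B.
  by apply: sums_min; [exact: submod_sums|apply: subset_trans NN' (sums_left _)|
     exact: sums_right].
exists p.+1, q; split; first by rewrite addSn.
  apply: chain_snoc cp; first exact: submodI.
  split=> [v [Nv Bv]|h]; first by split=> //; exact: NN'.
  by apply: nI; apply/seteqP; split=> // v [Nv Bv]; split=> //; exact: NN'.
exact: chain_sub cq.
Qed.

Lemma finite_length_bound A B b : submodule A -> A `<=` B ->
  (forall n, chain_between A B n -> (n <= b)%N) -> finite_length A B.
Proof.
move=> sA AB bnd.
have ex : exists n, `[< chain_between A B n >] by exists 0%N; apply/asboolP/chain0.
have ub n : `[< chain_between A B n >] -> (n <= b)%N by move/asboolP/bnd.
case: (ex_maxnP ex ub) => l /asboolP cl ml; exists l; split=> // k ck.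
by apply: ml; apply/asboolP.
Qed.

Lemma len_le_bound A B b : submodule A -> A `<=` B ->
  (forall n, chain_between A B n -> (n <= b)%N) -> finite_length A B /\ (len A B <= b)%N.
Proof.
move=> sA AB bnd; have fl := finite_length_bound sA AB bnd; split=> //.
by apply: bnd; case: (lenP fl).
Qed.

Lemma chain_le_len A B n : finite_length A B -> chain_between A B n -> (n <= len A B)%N.
Proof. by move=> /lenP [_]; exact. Qed.

(** [chain_split] bounds the chains of [C / A] by the sum, and concatenation attains it. *)
Lemma finite_length_add A B C : submodule A -> submodule B -> submodule C ->
  A `<=` B -> B `<=` C -> finite_length A B -> finite_length B C ->
  finite_length A C /\ len A C = (len A B + len B C)%N.
Proof.
move=> sA sB sC AB BC fAB fBC.
have [fl le] : finite_length A C /\ (len A C <= len A B + len B C)%N.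
  apply: len_le_bound => // [|n cn]; first exact: subset_trans BC.
  have [p [q [npq cp cq]]] := chain_split sB AB BC sC sA cn.
  by apply: leq_trans npq _; apply: leq_add; exact: chain_le_len.
split=> //; apply/eqP; rewrite eqn_leq le; apply: chain_le_len => //.
by apply: chain_cat (lenP _).1 (lenP _).1.
Qed.

Lemma finite_length_sub A B C D : submodule B -> A `<=` B -> B `<=` C -> C `<=` D ->
  finite_length A D -> finite_length B C.
Proof.
move=> sB AB BC CD fl; apply: (@finite_length_bound _ _ (len A D)) => // n cn.
by apply: chain_le_len => //; apply: chain_sub cn.
Qed.

Lemma lenD A B C : submodule A -> submodule B -> submodule C ->
  A `<=` B -> B `<=` C -> finite_length A C -> len A C = (len A B + len B C)%N.
Proof.
move=> sA sB sC AB BC fl; apply: (finite_length_add sA sB sC AB BC _ _).2.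
  exact: finite_length_sub fl.
by apply: finite_length_sub fl.
Qed.

Lemma len_refl A : submodule A -> finite_length A A /\ len A A = 0%N.
Proof.
move=> sA; have : length_is A A 0; last by move=> l0; split; [exists 0%N|exact: lenE].
split; first exact: chain0.
move=> [//|k] [N [Nb Ns]]; have [_ AN NA] := Nb 0%N isT; have [_ AN' NA'] := Nb 1%N isT.
by case: (Ns 0%N isT) => _ []; exact: subset_trans AN.
Qed.

Lemma len_eq0 A B : submodule A -> submodule B -> A `<=` B -> finite_length A B ->
  len A B = 0%N -> A = B.
Proof.
move=> sA sB AB fl l0; apply: contrapT => nAB.
have : chain_between A B 1.
  apply: chain_snoc (chain0 sA (@subset_refl _ A)) => //; split=> // BA.
  by apply: nAB; apply/seteqP.
by move/(chain_le_len fl); rewrite l0.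
Qed.

End Lengths.

Section LinearFunctions.
Variables (R : comNzRingType) (M M' : lmodType R) (f : M -> M').
Hypothesis f_lin : linear f.

Lemma linear_fun0 : f 0 = 0.
Proof using f_lin. by have := f_lin (-1) 0 0; rewrite scaler0 addr0 scaleN1r addNr. Qed.

Lemma linear_funD u v : f (u + v) = f u + f v.
Proof using f_lin. by rewrite -{1}[u]scale1r f_lin scale1r. Qed.

Lemma linear_funZ a u : f (a *: u) = a *: f u.
Proof using f_lin. by rewrite -[a *: u]addr0 f_lin linear_fun0 addr0. Qed.

Lemma linear_funB u v : f (u - v) = f u - f v.
Proof using f_lin. by rewrite linear_funD -scaleN1r linear_funZ scaleN1r. Qed.

Lemma submod_preimage (N : set M') : submodule N -> submodule (f @^-1` N).
Proof using f_lin.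
move=> sN; apply/submoduleP; split; first by rewrite /preimage /= linear_fun0; exact: submod0.
by move=> a u v /= Nu Nv; rewrite f_lin; apply: submodD => //; exact: submodZ.
Qed.

Lemma submod_image (N : set M) : submodule N -> submodule (f @` N).
Proof using f_lin.
move=> sN; apply/submoduleP; split; first by exists 0; [exact: submod0|exact: linear_fun0].
move=> a _ _ [u Nu <-] [v Nv <-]; exists (a *: u + v); last exact: f_lin.
by apply: submodD => //; exact: submodZ.
Qed.

End LinearFunctions.

Lemma scale_linear (R : comNzRingType) (M : lmodType R) (a : R) :
  linear (fun v : M => a *: v).
Proof. by move=> b u v; rewrite scalerDr !scalerA mulrC. Qed.

Definition linear_of (R : comNzRingType) (M M' : lmodType R) (f : M -> M')
  (f_lin : linear f) : {linear M -> M'} :=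
  HB.pack f (GRing.isLinear.Build R M M' *:%R f f_lin).

(** [len_embed] is for the case that [f] induces an injection [B / A -> B' / A'], the other
    transfer lemmas for the case that it induces an isomorphism. Linearity is asked of a bare
    function, so that evaluation maps and multiplications qualify directly. *)
Section Transfer.
Variables (R : comNzRingType) (M M' : lmodType R) (f : M -> M').
Hypothesis f_lin : linear f.
Variables (A B : set M) (A' B' : set M').
Hypotheses (sA : submodule A) (sB : submodule B) (sA' : submodule A') (sB' : submodule B').
Hypotheses (AB : A `<=` B) (A'B' : A' `<=` B').
Hypothesis fB : forall v, B v -> B' (f v).
Hypothesis fA : forall v, B v -> (A' (f v) <-> A v).

Lemma chain_image n : chain_between A B n -> chain_between A' B' n.
Proof using All.
pose F (N : set M) := sums (f @` N) A'.
move=> [N [Nb Ns]].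
have simg i : (i <= n)%N -> submodule (f @` (N i)).
  by move=> /Nb [sN _ _]; exact: submod_image.
exists (fun i => F (N i)); split=> i lin.
  have [sN AN NB] := Nb i lin; split; first by apply: submod_sums => //; exact: simg.
    by apply: sums_right; exact: simg.
  by apply: sums_min => // _ [u /NB Bu <-]; exact: fB.
have [sN AN NB] := Nb i (ltnW lin); have [sN' AN' NB'] := Nb i.+1 lin.
have [NN' nN'N] := Ns i lin; split.
  move=> _ [u [v [[w /NN' Nw fw] A'v ->]]]; exists u, v; split=> //.
  by exists w.
move=> h; apply: nN'N => v N'v.
have : F (N i) (f v) by apply: h; apply: sums_left => //; exists v.
move=> [_ [w [[u Nu <-] A'w fvE]]].
have Av : A (v - u).
  apply/fA; first by apply: submodB => //; [exact: NB'|exact: NB].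
  by rewrite (linear_funB f_lin) fvE addrAC subrr add0r.
by rewrite -(subrK u v); apply: submodD => //; exact: AN.
Qed.

Lemma len_embed : finite_length A' B' -> finite_length A B /\ (len A B <= len A' B')%N.
Proof using All.
move=> fl; apply: len_le_bound => // n /chain_image; exact: chain_le_len.
Qed.

Hypothesis f_onto : forall w, B' w -> exists2 v, B v & A' (w - f v).

Lemma chain_preimage n : chain_between A' B' n -> chain_between A B n.
Proof using All.
move=> [N [Nb Ns]]; exists (fun i => B `&` f @^-1` (N i)); split=> i lin.
  have [sN AN NB] := Nb i lin; split.
  - by apply: submodI => //; exact: submod_preimage.
  - by move=> v Av; split; [exact: AB|apply: AN; apply/fA => //; exact: AB].
  - by move=> v [].
have [sN AN NB] := Nb i (ltnW lin); have [sN' AN' NB'] := Nb i.+1 lin.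
have [NN' nN'N] := Ns i lin; split; first by move=> v [Bv Nv]; split=> //; exact: NN'.
move=> h; apply: nN'N => w N'w; have [v Bv A'v] := f_onto (NB' _ N'w).
have [] : (B `&` f @^-1` (N i)) v.
  apply: h; split=> //=; rewrite -(subKr w (f v)); apply: submodB => //.
  exact: AN'.
by move=> _ /= Nfv; rewrite -(subrK (f v) w); apply: submodD => //; exact: AN.
Qed.

Lemma length_is_transfer l : length_is A B l <-> length_is A' B' l.
Proof using All.
split=> -[c m]; split=> [|k].
- exact: chain_image.
- by move/chain_preimage/m.
- exact: chain_preimage.
- by move/chain_image/m.
Qed.

Lemma finite_length_transfer : finite_length A B <-> finite_length A' B'.
Proof using All. by split=> -[l /length_is_transfer]; exists l. Qed.

Lemma len_transfer : len A B = len A' B'.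
Proof using All.
by rewrite /len; congr xget; apply/funext => l; apply/propext/length_is_transfer.
Qed.

End Transfer.

(** * Ascending chains and finite generation *)

Section Chains.
Variables (R : comNzRingType) (M : lmodType R).
Implicit Types (A B C N : set M) (s : seq M).

(** The submodule generated by a list, built by successive adjunctions so that inductions on the
    number of generators are inductions on the list. *)
Definition gens s : set M := foldr (fun u N => adjoin N u) [set 0] s.

Lemma submod_gens s : submodule (gens s).
Proof. by elim: s => [|u s IH]; [exact: submod_zero|exact: submod_adjoin]. Qed.

Lemma gens_in s u : u \in s -> gens s u.
Proof.
elim: s => // v s IH; rewrite inE => /orP[/eqP->|/IH us].
  exact: adjoin_self (submod_gens s).
exact: sub_adjoin.
Qed.

Lemma gens_min s N : submodule N -> (forall u, u \in s -> N u) -> gens s `<=` N.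
Proof.
move=> sN; elim: s => [|v s IH] sub; first by move=> _ ->; exact: submod0.
apply: adjoin_min => //; last by apply: sub; rewrite mem_head.
by apply: IH => u us; apply: sub; rewrite inE us orbT.
Qed.

Lemma span_gens n (v : 'I_n -> M) : span (range v) = gens (codom v).
Proof.
apply/seteqP; split.
  by apply: span_min (submod_gens _) _ => _ [i _ <-]; apply: gens_in; exact: codom_f.
apply: gens_min (submod_span _) _ => _ /codomP[i ->]. by apply: span_incl; exists i.
Qed.

Lemma generated_byP n N : generated_by n N <-> exists2 s, size s = n & N = gens s.
Proof.
split=> [[v <-]|[s <- ->]].
  by exists (codom v); [rewrite size_codom card_ord|exact: span_gens].
exists (fun i : 'I_(size s) => s`_i); apply/seteqP; split.
  by apply: span_min (submod_gens _) _ => _ [i _ <-]; apply: gens_in; exact: mem_nth.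
apply: gens_min (submod_span _) _ => u us; apply: span_incl.
by exists (Ordinal (etrans (index_mem u s) us)) => //=; rewrite nth_index.
Qed.

(** The ascending chain condition on [B / A]. *)
Definition acc A B : Prop := forall N : nat -> set M,
  (forall i, [/\ submodule (N i), A `<=` N i & N i `<=` B]) ->
  (forall i, N i `<=` N i.+1) -> exists k, forall i, (k <= i)%N -> N i = N k.

Lemma ascending_le (N : nat -> set M) : (forall i, N i `<=` N i.+1) ->
  forall i j, (i <= j)%N -> N i `<=` N j.
Proof.
move=> NS i j /subnK <-; elim: (j - i)%N => [//|k IH]; rewrite addSn.
exact: subset_trans (NS _).
Qed.

Lemma acc_cat A B C : submodule B -> A `<=` B -> B `<=` C -> submodule C ->
  acc A B -> acc B C -> acc A C.
Proof.
move=> sB AB BC sC aAB aBC N Nb NS.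
have [k1 k1P] : exists k, forall i, (k <= i)%N -> N i `&` B = N k `&` B.
  apply: (aAB (fun i => N i `&` B)) => i; last exact: setSI.
  have [sN AN NC] := Nb i; split; first exact: submodI.
    by move=> v Av; split; [exact: AN|exact: AB].
  exact: subIsetr.
have [k2 k2P] : exists k, forall i, (k <= i)%N -> sums (N i) B = sums (N k) B.
  apply: (aBC (fun i => sums (N i) B)) => i; have [sN AN NC] := Nb i.
    by split; [exact: submod_sums|exact: sums_right|exact: sums_min].
  have [sN' _ _] := Nb i.+1; apply: sums_min; first exact: submod_sums.
    exact: subset_trans (NS i) (sums_left sB).
  exact: sums_right.
exists (maxn k1 k2) => i; rewrite geq_max => /andP[i1 i2].
have [sk _ _] := Nb (maxn k1 k2); have [si _ _] := Nb i.
apply/esym/(modular_law sk si sB).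
- by apply: ascending_le => //; rewrite geq_max i1.
- by rewrite k1P ?leq_maxl // (k1P i).
- by rewrite k2P ?leq_maxr // (k2P i).
Qed.

Lemma acc_refl A : acc A A.
Proof.
by move=> N Nb _; exists 0%N => i _; apply/seteqP; have [? ? ?] := Nb i; have [? ? ?] := Nb 0%N;
  split; exact: (@subset_trans _ A).
Qed.

End Chains.

Lemma acc_sub (R : comNzRingType) (M : lmodType R) (A A' B : set M) :
  A `<=` A' -> acc A B -> acc A' B.
Proof.
move=> AA' aAB N Nb; apply: aAB => i; have [s h1 h2] := Nb i; split=> //.
exact: subset_trans h1.
Qed.

Lemma ring_finitely_generated (R : comNzRingType) : finitely_generated [set: R^o].
Proof.
exists 1%N; apply/generated_byP; exists [:: (1 : R^o)] => //.
apply/seteqP; split=> // a _; exists 0, a; split=> //; last first.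
  by rewrite add0r /GRing.scale /= ?mulr1.
by exists a; rewrite /GRing.scale /= mulr1.
Qed.

Section Noetherian.
Variable R : comNzRingType.
Hypothesis R_noeth : noetherian R.

Lemma noetherian_acc : @acc R R^o [set 0] [set: R^o].
Proof using R_noeth.
move=> N Nb NS; pose U : set R^o := [set u | exists i, N i u].
have le := ascending_le NS.
have sU : submodule U.
  apply/submoduleP; split; first by exists 0%N; have [s _ _] := Nb 0%N; exact: submod0.
  move=> a u v [i Nu] [j Nv]; exists (maxn i j); have [s _ _] := Nb (maxn i j).
  apply: submodD => //; last exact: le _ _ (leq_maxr i j) _ Nv.
  by apply: submodZ => //; exact: le _ _ (leq_maxl i j) _ Nu.
have [n /generated_byP[s _ Us]] := R_noeth sU.
have [k kP] : exists k, forall u, u \in s -> N k u.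
  have: forall u, u \in s -> U u by move=> u; rewrite Us; exact: gens_in.
  elim: s {Us} => [|v s IH] sub; first by exists 0%N.
  have [k kP] := IH (fun u us => sub u (mem_behead (s := v :: s) us)).
  have [j jP] := sub v (mem_head _ _).
  exists (maxn k j) => u; rewrite inE => /orP[/eqP->|/kP Nku].
    exact: le _ _ (leq_maxr k j) _ jP.
  exact: le _ _ (leq_maxl k j) _ Nku.
exists k => i ki; apply/seteqP; split; last exact: le.
move=> u Nu; have : U u by exists i.
by rewrite Us; apply: gens_min => //; case: (Nb k).
Qed.

(** A submodule [N] between [A] and [A + R u] is determined by the ideal of the [a] with
    [a *: u] in [N]. *)
Lemma acc_adjoin (M : lmodType R) (A : set M) u : submodule A -> acc A (adjoin A u).
Proof using R_noeth.
move=> sA N Nb NS.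
have le := ascending_le NS.
pose I i := [set a : R^o | N i (a *: u)].
have [k kP] : exists k, forall i, (k <= i)%N -> I i = I k.
  apply: noetherian_acc => i; last by move=> a; exact: NS.
  have [sN AN NC] := Nb i; split=> //; last first.
    by move=> a ->; rewrite /I /= scale0r; exact: submod0.
  apply/submoduleP; split; first by rewrite /I /= scale0r; exact: submod0.
  move=> a b c /= Nb' Nc; rewrite /I /= scalerDl -scalerA.
  by apply: submodD => //; exact: submodZ.
exists k => i ki; apply/seteqP; split; last exact: le.
have [si Ai iA] := Nb i; have [sk Ak kA] := Nb k.
move=> v Nv; have [a [_ [Aa [r ->] vE]]] := iA _ Nv.
have Nr : N i (r *: u) by apply: (submodDr si (Ai _ Aa)); rewrite -vE.
rewrite vE; apply: submodD => //; first exact: Ak.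
by have : I k r by rewrite -(kP i ki).
Qed.

Lemma acc_finitely_generated (M : lmodType R) :
  finitely_generated [set: M] -> acc [set (0 : M)] [set: M].
Proof using R_noeth.
move=> [n /generated_byP[s _ ->]]; elim: s => [|u s IH]; first exact: acc_refl.
apply: (acc_cat _ _ _ _ IH (@acc_adjoin _ _ u (submod_gens s))).
- exact: submod_gens.
- by move=> _ ->; apply: submod0; exact: submod_gens.
- exact: sub_adjoin.
- exact: (submod_gens (u :: s)).
Qed.

(** Noetherian induction: to prove that a property holds of all ideals, take [P] to be its
    negation and examine a maximal counterexample. *)
Lemma maximal_among (P : set R^o -> Prop) (I0 : set R^o) : submodule I0 -> P I0 ->
  exists I, [/\ submodule I, P I, I0 `<=` I &
    forall J, submodule J -> I `<=` J -> P J -> J = I].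
Proof using R_noeth.
move=> sI0 PI0; apply: contrapT => nex.
pose T := {I : set R^o | [/\ submodule I, P I & I0 `<=` I]}.
have step (I : T) : exists J : T, sval I `<=` sval J /\ sval J <> sval I.
  case: I => I [sI PI I0I] /=; apply: contrapT => nJ; apply: nex; exists I; split=> //.
  move=> J sJ IJ PJ; apply: contrapT => JI; apply: nJ.
  have tJ : [/\ submodule J, P J & I0 `<=` J] by split=> //; exact: subset_trans IJ.
  by exists (exist _ J tJ).
pose next I := sval (cid (step I)).
pose F i := iter i next (exist _ I0 (And3 sI0 PI0 (@subset_refl _ _)) : T).
have [k kP] : exists k, forall i, (k <= i)%N -> sval (F i) = sval (F k).
  apply: noetherian_acc => i; last exact: (svalP (cid (step (F i)))).1.
  have [s _ _] := svalP (F i); split=> // a ->; exact: submod0.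
by have := (svalP (cid (step (F k)))).2; apply; exact: (kP k.+1 (leqnSn k)).
Qed.

End Noetherian.

(** * Local rings *)

Section LocalRings.
Variables (R : comNzRingType) (m : set R).
Hypotheses (R_noeth : noetherian R) (R_local : local_ring m).

Lemma submod_m : @submodule R R^o m.
Proof using R_local. by case: R_local => -[]. Qed.

Lemma notin_m1 : ~ m 1.
Proof using R_local. by case: R_local => -[]. Qed.

Lemma proper_sub_m (I : set R^o) : submodule I -> ~ I 1 -> I `<=` m.
Proof using R_noeth R_local.
move=> sI I1; have [J [sJ J1 IJ Jmax]] := @maximal_among R R_noeth (fun J => ~ J 1) _ sI I1.
have Jm : maximal_ideal J by split=> // K sK JK K1; exact: Jmax.
by case: R_local => _ /(_ _ Jm) <-.
Qed.

Lemma inverse_notin_m (a : R) : ~ m a -> exists b, b * a = 1.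
Proof using R_noeth R_local.
move=> ma; apply: contrapT => nb; apply: ma; apply: (@proper_sub_m (line (a : R^o))).
- exact: submod_line.
- by move=> [b bE]; apply: nb; exists b.
- exact: line_self.
Qed.

Lemma inverse_one_sub (a : R) : m a -> exists b, b * (1 - a) = 1.
Proof using R_noeth R_local.
move=> ma; apply: inverse_notin_m => h; apply: notin_m1.
by rewrite -(subrK a 1); exact: (submodD submod_m).
Qed.

Lemma m_prime (a b : R) : m (a * b) -> ~ m a -> m b.
Proof using R_noeth R_local.
move=> mab /inverse_notin_m[c ca]; rewrite -[b]mul1r -ca -mulrA.
exact: (submodZ c submod_m).
Qed.

Section Modules.
Variable M : lmodType R.
Implicit Types (A B N : set M) (s : seq M).

Lemma submod_cancel A (b : R) u : submodule A -> m b -> A ((1 - b) *: u) -> A u.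
Proof using R_noeth R_local.
move=> sA /inverse_one_sub[c cE] /(submodZ c sA); by rewrite scalerA cE scale1r.
Qed.

(** The generators are discarded one at a time: [v] is [b *: v] plus a combination of the others
    modulo [A], with [b] in [m], and [1 - b] is invertible. *)
Lemma nakayama A B : submodule A -> finitely_generated B ->
  B `<=` sums A (smul m B) -> B `<=` A.
Proof using R_noeth R_local.
move=> sA [n /generated_byP[s0 _ BE]] BmB.
have sB : submodule B by rewrite BE; exact: submod_gens.
suff H s : (forall u, u \in s -> B u) -> B `<=` sums A (gens s) -> B `<=` A.
  apply: (H s0); first by move=> u; rewrite BE; exact: gens_in.
  by rewrite {1}BE; exact: sums_right.
elim: s => [_ h|v s IH Bs h].
  by apply: subset_trans h _; apply: sums_min => // _ ->; exact: submod0.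
have Bs' u : u \in s -> B u by move=> us; apply: Bs; rewrite inE us orbT.
apply: IH => //; apply: (subset_trans h).
have sAs : submodule (sums A (gens s)) by exact: submod_sums sA (submod_gens s).
apply: sums_min => //; first exact: sums_left (submod_gens s).
apply: adjoin_min => //; first exact: sums_right.
pose D := [set w | exists b g, [/\ m b, sums A (gens s) g & w = b *: v + g]].
have sD : submodule D.
  apply/submoduleP; split.
    exists 0, 0; rewrite scale0r addr0; split=> //; [exact: (submod0 submod_m)|exact: submod0].
  move=> a _ _ [b [g [mb Ag ->]]] [b' [g' [mb' Ag' ->]]].
  exists (a * b + b'), (a *: g + g'); split.
  - by apply: (submodD submod_m) => //; exact: (submodZ a submod_m).
  - by apply: submodD => //; exact: submodZ.
  - by rewrite scalerDr scalerA scalerDl addrACA.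
have {}h : D v.
  have Bv : B v by apply: Bs; rewrite mem_head.
  apply: (sums_min sD _ _ (BmB _ Bv)).
    move=> a Aa; exists 0, a; rewrite scale0r add0r; split=> //; first exact: (submod0 submod_m).
    by apply: sums_left => //; exact: submod_gens.
  apply: smul_min => // b w mb /h [a [_ [Aa [g [_ [gs [r ->] ->]]] ->]]].
  exists (b * r), (b *: a + b *: g); split; last by rewrite !scalerDr scalerA addrA addrC.
    by rewrite mulrC; exact: (submodZ r submod_m).
  by exists (b *: a), (b *: g); split=> //; apply: submodZ => //; exact: submod_gens.
case: h => b [g [mb Ag vE]]; apply: (submod_cancel sAs mb).
by rewrite scalerBl scale1r {1}vE addrAC subrr add0r.
Qed.

(** When [m u] lies in [A], the quotient [(A + R u) / A] is zero or simple. Such steps serve as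
    composition factors below. *)
Lemma adjoin_simple A N u : submodule A -> submodule N ->
  (forall b, m b -> A (b *: u)) -> A `<=` N -> N `<=` adjoin A u -> N `<=` A \/ N u.
Proof using R_noeth R_local.
move=> sA sN mu AN NA; have [|nNA] := pselect (N `<=` A); [by left|right].
have [v [Nv Av]] : exists v, N v /\ ~ A v.
  by apply: contrapT => h; apply: nNA => v Nv; apply: contrapT => Av; apply: h; exists v.
have [a [_ [Aa [r ->] vE]]] := NA v Nv.
have /inverse_notin_m[c cr] : ~ m r by move=> /mu Aru; apply: Av; rewrite vE; exact: submodD.
rewrite -[u]scale1r -cr -scalerA; apply: submodZ => //.
by apply: (submodDr sN (AN _ Aa)); rewrite -vE.
Qed.

Lemma len_adjoin A u : submodule A -> (forall b, m b -> A (b *: u)) ->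
  finite_length A (adjoin A u) /\ (len A (adjoin A u) <= 1)%N.
Proof using R_noeth R_local.
move=> sA mu; apply: len_le_bound => //; first exact: sub_adjoin.
case=> [|[|n]] // [N [Nb Ns]].
have [s0 A0 N0] := Nb 0%N isT; have [s1 A1 N1] := Nb 1%N isT; have [s2 A2 N2] := Nb 2%N isT.
have [_ n10] := Ns 0%N isT; have [N12 n21] := Ns 1%N isT.
case: (adjoin_simple sA s1 mu A1 N1) => [N1A|N1u]; first by case: n10; exact: subset_trans A0.
case: n21; apply: subset_trans N2 _; exact: adjoin_min.
Qed.

Lemma len_adjoin1 A u : submodule A -> (forall b, m b -> A (b *: u)) -> ~ A u ->
  finite_length A (adjoin A u) /\ len A (adjoin A u) = 1%N.
Proof using R_noeth R_local.
move=> sA mu Au; have [fl le1] := len_adjoin sA mu; split=> //; apply/eqP.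
rewrite eqn_leq le1 lt0n; apply/eqP => l0; apply: Au.
rewrite (len_eq0 sA _ _ fl l0); first exact: adjoin_self.
  exact: submod_adjoin.
exact: sub_adjoin.
Qed.

(** Starting from [v], multiply by elements of [m] as long as the result is outside [A]; each
    time the length of [(A + R v) / A] drops. *)
Lemma socle_element A B v : submodule A -> submodule B -> A `<=` B -> finite_length A B ->
  B v -> ~ A v -> exists u, [/\ B u, ~ A u & forall b, m b -> A (b *: u)].
Proof using R_noeth R_local.
move=> sA sB AB fl.
have fA w : B w -> finite_length A (adjoin A w).
  move=> Bw; apply: finite_length_sub fl => //; first exact: sub_adjoin.
  exact: adjoin_min.
elim: (len A (adjoin A v)) {-2}v (leqnn (len A (adjoin A v))) => [|n IH] {}v le Bv Av.
  move: le; rewrite leqn0 => /eqP l0; case: Av.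
  rewrite (len_eq0 sA _ _ (fA _ Bv) l0); first exact: adjoin_self.
    exact: submod_adjoin.
  exact: sub_adjoin.
have [mv|nmv] := pselect (forall b, m b -> A (b *: v)); first by exists v.
have [b [mb Abv]] : exists b, m b /\ ~ A (b *: v).
  by apply: contrapT => h; apply: nmv => b mb; apply: contrapT => Ab; apply: h; exists b.
have Bbv : B (b *: v) by exact: submodZ.
apply: (IH (b *: v)) => //; rewrite -ltnS; apply: leq_trans le.
have sv := submod_adjoin v sA; have sbv := submod_adjoin (b *: v) sA.
have sub : adjoin A (b *: v) `<=` adjoin A v.
  by apply: adjoin_min => //; [exact: sub_adjoin|apply: submodZ => //; exact: adjoin_self].
rewrite (lenD sA sbv sv _ sub (fA _ Bv)); last exact: sub_adjoin.
rewrite -addn1 leq_add2l lt0n; apply/eqP => l0.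
have eA : adjoin A (b *: v) = adjoin A v.
  apply: len_eq0 l0 => //; apply: finite_length_sub (fA _ Bv) => //; exact: sub_adjoin.
have : adjoin A (b *: v) v by rewrite eA; exact: adjoin_self.
move=> [a [_ [Aa [r ->] vE]]]; apply: Av.
have mrb : m (r * b) by exact: (submodZ r submod_m).
by apply: (submod_cancel sA mrb); rewrite scalerBl scale1r -scalerA {1}vE addrK.
Qed.

(** The induction step for all arguments on the length of [B / A]: pass from [A] to [A + R u]. *)
Lemma len_pos_socle A B : submodule A -> submodule B -> A `<=` B -> finite_length A B ->
  (0 < len A B)%N -> exists u, [/\ B u, ~ A u, forall b, m b -> A (b *: u) &
     adjoin A u `<=` B /\ finite_length (adjoin A u) B /\ (len (adjoin A u) B).+1 = len A B].
Proof using R_noeth R_local.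
move=> sA sB AB fl lpos.
have [v [Bv Av]] : exists v, B v /\ ~ A v.
  apply: contrapT => h; move: lpos; have -> : B = A.
    apply/seteqP; split=> // v Bv; apply: contrapT => Av; apply: h; exists v; split=> //.
  by rewrite (len_refl sA).2.
have [u [Bu Au mu]] := socle_element sA sB AB fl Bv Av; exists u; split=> //.
have su := submod_adjoin u sA; have sub : adjoin A u `<=` B by exact: adjoin_min.
split=> //; split; first by apply: finite_length_sub fl => //; exact: sub_adjoin.
rewrite (lenD sA su sB (@sub_adjoin _ _ A u) sub fl) (len_adjoin1 sA mu Au).2.
by rewrite add1n.
Qed.

Lemma power_kills_finite_length A B : submodule A -> submodule B -> A `<=` B ->
  finite_length A B -> iter (len A B) (smul m) B `<=` A.
Proof using R_noeth R_local.
move=> sA sB; move: {2}(len A B) (erefl (len A B)) => n; elim: n A sA => [|n IH] A sA lE AB fl.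
  by rewrite lE /= (len_eq0 sA sB AB fl lE).
have lpos : (0 < len A B)%N by rewrite lE.
have [u [Bu Au mu [sub [fu]]]] := len_pos_socle sA sB AB fl lpos; rewrite lE => -[lu].
rewrite /=; apply: (@subset_trans _ (smul m (adjoin A u))).
  by apply: smulS; rewrite -lu; apply: IH => //; exact: submod_adjoin.
apply: smul_min => // b _ mb [a [_ [Aa [r ->] ->]]]; rewrite scalerDr.
by apply: submodD => //; [exact: submodZ|rewrite scalerA mulrC -scalerA; apply: submodZ => //; exact: mu].
Qed.

Definition gens_over A s : set M := foldr (fun u N => adjoin N u) A s.

Lemma submod_gens_over A s : submodule A -> submodule (gens_over A s).
Proof. by move=> sA; elim: s => [|u s IH] //; exact: submod_adjoin. Qed.

Lemma gens_over_base A s : submodule A -> A `<=` gens_over A s.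
Proof. by move=> sA; elim: s => [|u s IH] //; apply: subset_trans IH _; exact: sub_adjoin. Qed.

Lemma gens_over_sums A s : submodule A -> gens_over A s = sums (gens s) A.
Proof.
move=> sA; apply/seteqP; split; last first.
  apply: sums_min; [exact: submod_gens_over| |exact: gens_over_base].
  apply: gens_min; [exact: submod_gens_over|move=> u].
  elim: s => // v s IH; rewrite inE => /orP[/eqP->|/IH us].
    by apply: adjoin_self; exact: submod_gens_over.
  exact: sub_adjoin.
have sS t : submodule (sums (gens t) A) by exact: submod_sums (submod_gens t) sA.
elim: s => [|u s IH]; first by apply: sums_right; exact: submod_zero.
apply: adjoin_min => //.
  apply: subset_trans IH _; apply: sums_min => //; last by apply: sums_right; exact: (submod_gens (u :: s)).
  by apply: subset_trans (@sub_adjoin _ _ _ u) (sums_left sA).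
by apply: sums_left => //; apply: gens_in; rewrite mem_head.
Qed.

(** A composition series of [B / A] provides one generator for each simple factor. *)
Lemma len_generators A B : submodule A -> submodule B -> A `<=` B -> finite_length A B ->
  exists2 s, size s = len A B & B = gens_over A s.
Proof using R_noeth R_local.
move=> sA sB; move: {2}(len A B) (erefl (len A B)) => n; elim: n A sA => [|n IH] A sA lE AB fl.
  by exists [::]; rewrite ?lE //= (len_eq0 sA sB AB fl lE).
have lpos : (0 < len A B)%N by rewrite lE.
have [u [Bu Au mu [sub [fu]]]] := len_pos_socle sA sB AB fl lpos; rewrite lE => -[lu].
have [s sz BE] := IH _ (submod_adjoin u sA) lu sub fu.
exists (rcons s u); first by rewrite size_rcons sz lu.
by rewrite BE /gens_over foldr_rcons.
Qed.

Lemma len_generators_le A s : submodule A -> (forall u b, u \in s -> m b -> A (b *: u)) ->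
  finite_length A (gens_over A s) /\ (len A (gens_over A s) <= size s)%N.
Proof using R_noeth R_local.
move=> sA; elim: s => [|u s IH] mA; first by have [] := len_refl sA => ? /= ->.
have [fs ls] := IH (fun v b vs => mA v b (mem_behead (s := u :: s) vs)).
have ss := submod_gens_over s sA; have As := gens_over_base s sA.
have [fu lu] : finite_length (gens_over A s) (adjoin (gens_over A s) u) /\
    (len (gens_over A s) (adjoin (gens_over A s) u) <= 1)%N.
  by apply: len_adjoin => // b mb; apply: As; apply: mA => //; rewrite mem_head.
have [fl ->] := finite_length_add sA ss (submod_adjoin u ss) As (@sub_adjoin _ _ _ u) fs fu.
by split=> //=; rewrite -addn1; exact: leq_add.
Qed.

End Modules.

(** An order-reversing map that jumps by at most one (respectively by at least one) along each
    simple step shrinks (respectively does not shrink) lengths. *)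
Section Antitone.
Variables (M M' : lmodType R) (Phi : set M -> set M') (A B : set M).
Hypotheses (sA : submodule A) (sB : submodule B) (AB : A `<=` B) (fl : finite_length A B).
Hypothesis sPhi : forall K, submodule K -> submodule (Phi K).
Hypothesis PhiS : forall K K', K `<=` K' -> Phi K' `<=` Phi K.

Lemma antitone_len_le :
  (forall K u, submodule K -> A `<=` K -> K `<=` B -> B u -> ~ K u ->
     (forall b, m b -> K (b *: u)) ->
     finite_length (Phi (adjoin K u)) (Phi K) /\ (len (Phi (adjoin K u)) (Phi K) <= 1)%N) ->
  finite_length (Phi B) (Phi A) /\ (len (Phi B) (Phi A) <= len A B)%N.
Proof using All.
move=> step; move: {2}(len A B) (erefl (len A B)) => n lE.
elim: n A sA AB fl lE step => [|n IH] K sK KB fK lE step.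
  by rewrite (len_eq0 sK sB KB fK lE); have [f0 ->] := len_refl (sPhi sB).
have lpos : (0 < len K B)%N by rewrite lE.
have [u [Bu Ku mu [sub [fu]]]] := len_pos_socle sK sB KB fK lpos; rewrite lE => -[lu].
have su := submod_adjoin u sK; have Ksub := @sub_adjoin _ _ K u.
have [f1 l1] := IH _ su sub fu lu (fun K' v sK' h => step K' v sK' (subset_trans Ksub h)).
have [f2 l2] := step K u sK (@subset_refl _ K) KB Bu Ku mu.
have [f3 ->] := finite_length_add (sPhi sB) (sPhi su) (sPhi sK) (PhiS sub) (PhiS Ksub) f1 f2.
by split=> //; rewrite -addn1 -lu; exact: leq_add.
Qed.

Lemma antitone_chain :
  (forall K u, submodule K -> A `<=` K -> K `<=` B -> B u -> ~ K u ->
     (forall b, m b -> K (b *: u)) -> ~ (Phi K `<=` Phi (adjoin K u))) ->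
  chain_between (Phi B) (Phi A) (len A B).
Proof using All.
move=> step; move: {2}(len A B) (erefl (len A B)) => n lE.
elim: n A sA AB fl lE step => [|n IH] K sK KB fK lE step.
  by rewrite lE; apply: chain0; [exact: sPhi|exact: PhiS].
have lpos : (0 < len K B)%N by rewrite lE.
have [u [Bu Ku mu [sub [fu]]]] := len_pos_socle sK sB KB fK lpos; rewrite lE => -[lu].
have su := submod_adjoin u sK; have Ksub := @sub_adjoin _ _ K u.
rewrite -lu; apply: (@chain_snoc _ _ _ (Phi (adjoin K u))); first exact: sPhi.
  by split; [exact: PhiS|exact: step].
by apply: IH => // K' v sK' h; apply: step => //; exact: subset_trans h.
Qed.

End Antitone.
End LocalRings.

(** * Dimension one *)

Definition regular_on (R : comNzRingType) (M : lmodType R) (y : R) : Prop :=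
  forall v : M, y *: v = 0 -> v = 0.

Lemma regular_inj (R : comNzRingType) (M : lmodType R) (y : R) (u v : M) :
  regular_on M y -> y *: u = y *: v -> u = v.
Proof.
move=> ry yuv; apply/eqP; rewrite -subr_eq0; apply/eqP/ry.
by rewrite scalerBr yuv subrr.
Qed.

Lemma regular_mul (R : comNzRingType) (M : lmodType R) (x y : R) :
  regular_on M x -> regular_on M y -> regular_on M (x * y).
Proof. by move=> rx ry v; rewrite -scalerA => /rx/ry. Qed.

Lemma regular_exp (R : comNzRingType) (M : lmodType R) (y : R) n :
  regular_on M y -> regular_on M (y ^+ n).
Proof.
move=> ry; elim: n => [|n IH]; first by move=> v; rewrite expr0 scale1r.
by rewrite exprS; exact: regular_mul.
Qed.

Lemma len_homothety (R : comNzRingType) (M : lmodType R) (y : R) (A B : set M) :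
  regular_on M y -> submodule A -> submodule B -> A `<=` B ->
  (finite_length (homothety y A) (homothety y B) <-> finite_length A B) /\
  len (homothety y A) (homothety y B) = len A B.
Proof.
move=> ry sA sB AB.
have lin := scale_linear (M := M) y.
have h1 v : B v -> homothety y B (y *: v) by move=> Bv; exists v.
have h2 v : B v -> (homothety y A (y *: v) <-> A v).
  by move=> _; split=> [[w Aw /(regular_inj ry) ->]|Av] //; exists v.
have h3 w : homothety y B w -> exists2 v, B v & homothety y A (w - y *: v).
  by move=> [v Bv ->]; exists v => //; rewrite subrr; exact: (submod0 (submod_homothety _ sA)).
have sA' := submod_homothety y sA; have sB' := submod_homothety y sB.
have AB' := homothetyS (a := y) AB.
split; first by apply: iff_sym; exact: (finite_length_transfer lin).
by apply/esym; exact: (len_transfer lin).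
Qed.

Section DimensionOne.
Variables (R : comNzRingType) (m : set R).
Hypotheses (R_noeth : noetherian R) (R_local : local_ring m).
Hypothesis R_dim1 : krull_dim R^o = 1%N.

Let sm := submod_m R_local.
Let m1 := notin_m1 R_local.

(** Every prime of [R] contains the annihilator of [R], which is zero, so that any chain of primes
    counts for the dimension of the module [R^o]. *)
Lemma krull_dim_le1 (P : nat -> set R) n :
  (forall i, (i <= n)%N -> prime_ideal (P i)) ->
  (forall i, (i < n)%N -> P i `<` P i.+1) -> (n <= 1)%N.
Proof using R_dim1.
move=> prP chP; move: R_dim1; rewrite /krull_dim /nat_max.
set S := [set n | _]; case: xgetP => // k _ [_ kmax] k1.
rewrite -k1; apply: kmax; exists P; split=> // i lin; split; first exact: prP.
move=> a /= /(_ (1 : R^o)); rewrite /GRing.scale /= mulr1 => ->.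
by have [/submod0] := prP i lin.
Qed.

Lemma prime_m : prime_ideal m.
Proof using R_noeth R_local.
split=> // a b mab; have [ma|nma] := pselect (m a); [by left|right].
exact: (m_prime R_noeth R_local mab).
Qed.

(** A prime containing a regular [y] is not minimal: a maximal ideal among those
    that avoid every [y ^+ i * s] with [s] outside the prime is a smaller prime. *)
Lemma prime_with_regular (P : set R) (y : R) :
  prime_ideal P -> P y -> regular_on R^o y -> P = m.
Proof using R_noeth R_local R_dim1.
move=> [sP P1 pP] Py ry; apply: contrapT => Pm.
have Pm' : P `<=` m := proper_sub_m R_noeth R_local sP P1.
pose avoids (I : set R^o) := forall i s, ~ P s -> ~ I (y ^+ i * s).
have a0 : avoids [set 0].
  move=> i s Ps /= ys0; apply: Ps.
  have s0 : s = 0 := @regular_exp R R^o y i ry s ys0.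
  by rewrite s0; exact: (submod0 sP).
have [Q [sQ aQ _ Qmax]] := maximal_among R_noeth (submod_zero _) a0.
have Q1 : ~ Q 1 by move=> /= h; apply: (aQ 0%N 1 P1); rewrite expr0 mulr1.
have nQ a : ~ Q a -> exists i s q r, [/\ ~ P s, Q q & y ^+ i * s = q + r * a].
  move=> Qa; apply: contrapT => nex; apply: Qa.
  rewrite -(Qmax (adjoin (Q : set R^o) a)); first exact: adjoin_self.
  - exact: submod_adjoin.
  - exact: sub_adjoin.
  - move=> i s Ps [q [_ [Qq [r ->] e]]]; apply: nex; exists i, s, q, r; split=> //.
have prQ : prime_ideal Q.
  split=> // a b Qab; apply: contrapT => /not_orP[/nQ[i [s [q [r [Ps Qq e]]]]]].
  move=> /nQ[i' [s' [q' [r' [Ps' Qq' e']]]]].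
  apply: (aQ (i + i')%N (s * s')); first by move=> /pP[].
  have -> : y ^+ (i + i') * (s * s') = q' *: (q : R^o) + (r * a) *: (q' : R^o)
     + (r' * b) *: (q : R^o) + (r * r') *: (a * b : R^o).
    by rewrite exprD mulrACA e e' /GRing.scale /=; ring.
  by do !apply: (submodD sQ); exact: submodZ.
have Qy : ~ Q y by move=> h; apply: (aQ 1%N 1 P1); rewrite expr1 mulr1.
have QP : Q `<=` P.
  by move=> a Qa; apply: contrapT => Pa; apply: (aQ 0%N a Pa); rewrite expr0 mul1r.
suff : (2 <= 1)%N by [].
apply: (@krull_dim_le1 (fun i => if i is i'.+1 then if i' is _.+1 then m else P else Q)).
  by move=> [|[|i]] _ //; exact: prime_m.
move=> [|[|i]] // _; split=> //; first by move=> /(_ _ Py).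
by move=> mP; apply: Pm; apply/seteqP.
Qed.

Section Regular.
Variable y : R.
Hypothesis ry : regular_on R^o y.
Implicit Types I J : set R^o.

(** A maximal ideal among the annihilators [(J : a)] with [a] outside [J] is prime; it contains
    [y], so it is [m]. *)
Lemma ring_socle J : submodule J -> J y -> ~ J 1 ->
  exists a : R, ~ J a /\ forall b : R, m b -> J (b * a).
Proof using All.
move=> sJ Jy J1.
pose colon a := [set b : R^o | J (b * a)].
have sC a : submodule (colon a).
  apply/submoduleP; split; first by rewrite /colon /= mul0r; exact: submod0.
  move=> r u v /= Ju Jv; rewrite /colon /= mulrDl /GRing.scale /= -mulrA.
  by apply: submodD => //; exact: submodZ.
have [I [sI [a Ja IE] _ Imax]] := maximal_among R_noeth (P := fun I => exists2 a, ~ J a & I = colon a)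
   (sC 1) (ex_intro2 _ _ 1 J1 erefl).
exists a; split=> // b mb; suff IEm : I = m by move: mb; rewrite -IEm IE.
have Iy : I y by rewrite IE /colon /= mulrC; exact: (submodZ a sJ).
apply: (prime_with_regular _ Iy ry); split=> //; first by rewrite IE /colon /= mul1r.
move=> c d Icd; have [Jda|Jda] := pselect (J (d * a)); first by right; rewrite IE.
left; have <- : colon (d * a) = I.
  apply: Imax => //; last by exists (d * a).
  by rewrite IE => e Jea; rewrite /colon /= mulrCA; exact: (submodZ d sJ).
by rewrite /colon /= mulrA; move: Icd; rewrite IE.
Qed.

(** A maximal counterexample [J] is proper, and the socle step [J + R a] is not a
    counterexample. *)
Lemma finite_colength J : submodule J -> J y -> finite_length J [set: R^o].
Proof using All.
move=> sJ Jy; apply: contrapT => nfl.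
have [I [sI nI JI Imax]] := @maximal_among _ R_noeth (fun J => ~ finite_length J [set: R^o]) _ sJ nfl.
have Iy : I y by exact: JI.
have I1 : ~ I 1.
  move=> I1; apply: nI; have -> : [set: R^o] = I; last exact: (len_refl sI).1.
  apply/seteqP; split=> // a _; rewrite -[a]mulr1; exact: (submodZ a sI).
have [a [Ia ma]] := ring_socle sI Iy I1.
have sa : submodule (adjoin I a) by exact: submod_adjoin.
have sub := @sub_adjoin _ _ I a.
have [fa _] := len_adjoin R_noeth R_local sI ma.
apply: nI; apply: (finite_length_add sI sa (submodT _) sub _ fa _).1 => //.
apply: contrapT => nfa; apply: Ia; rewrite -(Imax _ sa sub nfa); exact: adjoin_self.
Qed.

End Regular.
End DimensionOne.

(** * The type as the length of a socle *)

(** The colon submodule [(A :_N J)]. *)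
Definition residual (R : comNzRingType) (M : lmodType R) (J : set R) (N A : set M) : set M :=
  [set v | N v /\ forall b, J b -> A (b *: v)].

(** Let [d0 : P_1 -> P_0] be the first differential and [p0] a lift of the generator of [R / m].
    As [x p0] is a boundary [d0 y1], a cocycle [f : P_1 -> M] can be evaluated at [y1], and
    [f |-> f y1] identifies [Ext^1 (R/m, M)] with [(xM : m) / xM]. A cocycle is a linear map on
    the image of [d0]; it extends to [P_0] when its values on [x P_0] are divisible by [x], which
    is decided by the value at [x p0]. Conversely [v] in [(xM : m)] comes from the map
    [p |-> (s p *: v) / x], where [s : P_0 -> R] lifts the augmentation. *)
Section ExtOne.
Variables (R : comNzRingType) (m : set R) (K M : lmodType R) (x : R).
Hypotheses (sm : @submodule R R^o m) (mx : m x) (rx : regular_on M x).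
Variables (q : {linear R^o -> K}) (P : projective_resolution K).
Hypotheses (q_onto : range q = [set: K]) (q_ker : forall a : R, q a = 0 <-> m a).

Let xM := homothety x [set: M].

Lemma ext1_length_is l :
  length_is (@ext_coboundaries R K M P 1) (@ext_cocycles R K M P 1) l <->
  length_is xM (residual m [set: M] xM) l.
Proof using All.
have sxM : submodule xM by exact: submod_homothety (submodT _).
pose d0 := pr_diff P 0; pose d1 := pr_diff P 1; pose aug := pr_aug P.
have ex0 z : aug z = 0 -> exists y, d0 y = z.
  move=> az; have : [set v | aug v = 0] z by [].
  by rewrite -(pr_exact0 P) => -[y _ <-]; exists y.
have aug_d0 y : aug (d0 y) = 0.
  have : range d0 (d0 y) by exists y.
  by rewrite (pr_exact0 P).
have [p0 p0E] : exists p0, aug p0 = q (1 : R^o).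
  have : [set: K] (q (1 : R^o)) by [].
  by rewrite -(pr_surj P) => -[p _ <-]; exists p.
have [s sE] : exists s : {linear pr_mod P 0 -> R^o}, forall p, q (s p) = aug p.
  exact: pr_projective.
have qE (a : R^o) : q a = a *: q (1 : R^o).
  by rewrite -linearZ /= /GRing.scale /= mulr1.
have xq a : m a -> forall k : K, a *: k = 0.
  move=> ma k; have : [set: K] k by [].
  rewrite -q_onto => -[b _ <-]; rewrite -linearZ /=; apply/q_ker.
  by rewrite /GRing.scale /= mulrC; exact: (submodZ b sm).
have [y1 y1E] : exists y1, d0 y1 = x *: p0 by apply: ex0; rewrite linearZ /= xq.
have cocycle_ker f y y' : @ext_cocycles R K M P 1 f -> d0 y = d0 y' -> f y = f y'.
  move=> [f_lin fd] e; have : [set v | d0 v = 0] (y - y') by rewrite /= linearB /= e subrr.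
  rewrite -(pr_exactS P 0) => -[z _ zE].
  have := fd z; rewrite zE (linear_funB f_lin) => /eqP; rewrite subr_eq0 => /eqP; exact.
have sB : submodule (@ext_cocycles R K M P 1).
  apply/submoduleP; split.
    by split=> [a u v|y] //=; rewrite scaler0 addr0.
  move=> a f g [f_lin fd] [g_lin gd]; split=> [b u v|y].
    rewrite !fctE /= f_lin g_lin !scalerDr !scalerA mulrC addrACA //.
  by rewrite !fctE fd gd scaler0 addr0.
have AB : @ext_coboundaries R K M P 1 `<=` @ext_cocycles R K M P 1.
  move=> _ [g ->]; split=> [a u v|y]; first by rewrite !linearP.
  have : range d1 (d1 y) by exists y.
  by rewrite (pr_exactS P 0) => /= ->; rewrite linear0.
have sA : submodule (@ext_coboundaries R K M P 1).
  apply/submoduleP; split.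
    have lin0 : linear (fun _ : pr_mod P 0 => 0 : M) by move=> a u v; rewrite scaler0 addr0.
    by exists (linear_of lin0).
  move=> a _ _ [g ->] [h ->].
  have lin : linear (fun p => a *: g p + h p).
    by move=> b u v; rewrite (linearP g) (linearP h) !scalerDr !scalerA mulrC addrACA.
  by exists (linear_of lin).
have fS : xM `<=` residual m [set: M] xM.
  by move=> v xv; split=> // b _; exact: submodZ.
have sS : submodule (residual m [set: M] xM).
  apply/submoduleP; split; first by split=> // b _; rewrite scaler0; exact: submod0.
  move=> a u v [_ hu] [_ hv]; split=> // b mb; rewrite scalerDr scalerA mulrC -scalerA.
  by apply: submodD => //; [apply: submodZ => //; exact: hu|exact: hv].
have lin : linear (fun f : pr_mod P 1 -> M => f y1) by [].
have dec p : exists z, p = s p *: p0 + d0 z.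
  have [z zE] : exists z, d0 z = p - s p *: p0.
    by apply: ex0; rewrite linearB linearZ /= p0E -qE sE subrr.
  by exists z; rewrite zE addrC subrK.
have fB f : @ext_cocycles R K M P 1 f -> residual m [set: M] xM (f y1).
  move=> cf; split=> // b mb; have [f_lin _] := cf.
  have [y yE] : exists y, d0 y = b *: p0 by apply: ex0; rewrite linearZ /= xq.
  exists (f y) => //; rewrite -!(linear_funZ f_lin); apply: cocycle_ker => //.
  by rewrite !linearZ /= y1E yE !scalerA mulrC.
apply: (length_is_transfer lin) => //.
- move=> f cf; have [f_lin _] := cf; split; last first.
    move=> [g ->]; exists (g p0) => //; by rewrite -/d0 y1E linearZ.
  move=> [v _ vE].
  have gex p : exists w, forall y, d0 y = x *: p -> f y = x *: w.
    have [z pE] := dec p; exists (s p *: v + f z) => y yE.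
    have -> : f y = f (s p *: y1 + x *: z).
      by apply: cocycle_ker => //; rewrite linearP /= linearZ /= y1E -/d0 yE {1}pE scalerDr !scalerA mulrC.
    by rewrite f_lin (linear_funZ f_lin) vE scalerDr !scalerA mulrC.
  pose g p := sval (cid (gex p)).
  have gP p y : d0 y = x *: p -> f y = x *: g p := svalP (cid (gex p)) y.
  have xp p : exists y, d0 y = x *: p by apply: ex0; rewrite linearZ /= xq.
  have g_lin : linear g.
    move=> a u v'; apply: (regular_inj rx).
    have [yu yuE] := xp u; have [yv yvE] := xp v'.
    rewrite -(gP _ (a *: yu + yv)); last by rewrite linearP /= -/d0 yuE yvE scalerDr !scalerA mulrC.
    by rewrite f_lin (gP _ _ yuE) (gP _ _ yvE) scalerDr !scalerA mulrC.
  exists (linear_of g_lin); apply/funext => y; apply: (regular_inj rx) => /=.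
  by rewrite -(gP (d0 y) (x *: y)) ?linearZ // (linear_funZ f_lin).
- move=> v [_ mv].
  have hex y : exists w, s (d0 y) *: v = x *: w.
    have /mv[w _ wE] : m (s (d0 y)) by apply/q_ker; rewrite sE aug_d0.
    by exists w.
  pose h y := sval (cid (hex y)).
  have hP y : s (d0 y) *: v = x *: h y := svalP (cid (hex y)).
  have h_lin : linear h.
    move=> a u w; apply: (regular_inj rx).
    have e : s (d0 (a *: u + w)) = a * s (d0 u) + s (d0 w) by rewrite (linearP d0) (linearP s).
    by rewrite -hP e scalerDl -scalerA !hP scalerDr !scalerA mulrC.
  exists h.
    split=> // y; apply: (regular_inj rx); rewrite -hP scaler0.
    have : range d1 (d1 y) by exists y.
    by rewrite (pr_exactS P 0) => /= ->; rewrite linear0 scale0r.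
  have : m (1 - s p0).
    by apply/q_ker; rewrite linearB /= sE p0E subrr.
  move/mv; rewrite scalerBl scale1r; congr (xM (v - _)).
  apply: (regular_inj rx); rewrite -hP y1E scalerA.
  by have -> : s (x *: p0) = x * s p0 by rewrite linearZ.
Qed.

End ExtOne.

Section TypeAndDepth.
Variables (R : comNzRingType) (m : set R).
Hypothesis sm : @submodule R R^o m.

Lemma nat_max_pos (S : set nat) n : nat_max S = n.+1 -> S n.+1.
Proof. by rewrite /nat_max; case: xgetP => // k _ [Sk _] <-. Qed.

Lemma depth1_regular (M : lmodType R) : depth m M = 1%N ->
  exists2 x, m x & regular_on M x.
Proof using Type.
move=> /nat_max_pos[s [sz sub [reg _]]]; case: s sz sub reg => [|x [|]] //= _ sub reg.
exists x; first by apply: sub; rewrite /= mem_head.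
move=> v xv0; have := reg 0%N isT v; rewrite /= xv0.
have s0 := submod_smul [set` [::]] [set: M].
move=> /(_ (submod0 s0)) h.
have : [set (0 : M)] v; last by [].
by apply: (smul_min (submod_zero M) _ h) => a w /=; rewrite in_nil.
Qed.

(** A projective resolution of [R / m] is needed to compute the type of [R]; one is provided by
    any module of type one, because the type would be zero by default otherwise. *)
Definition has_resolution : Prop :=
  exists (K : lmodType R) (q : {linear R^o -> K}) (_ : projective_resolution K),
    range q = [set: K] /\ forall a : R, q a = 0 <-> m a.

Lemma cm_type1_resolution (M : lmodType R) : cm_type m M = 1%N -> has_resolution.
Proof using Type.
rewrite /cm_type; case: xgetP => // k _ [K [q [q1 q2]] [P _]] _.
by exists K, q, P.
Qed.

Lemma cm_type_socle (M : lmodType R) (x : R) : has_resolution -> depth m M = 1%N ->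
  m x -> regular_on M x -> forall l, length_is (homothety x [set: M])
    (residual m [set: M] (homothety x [set: M])) l -> cm_type m M = l.
Proof using sm.
move=> [K [q [P [q1 q2]]]] d1 mx rx l len_l; rewrite /cm_type d1; apply: xget_unique.
  by exists K; [exists q|exists P; apply/(ext1_length_is sm mx rx P q1 q2)].
move=> k [K' [q' [q1' q2']] [P' /(ext1_length_is sm mx rx P' q1' q2') len_k]].
exact: length_is_unique len_k len_l.
Qed.

Lemma cm_type1_socle (M : lmodType R) (x : R) : depth m M = 1%N -> cm_type m M = 1%N ->
  m x -> regular_on M x -> length_is (homothety x [set: M])
    (residual m [set: M] (homothety x [set: M])) 1.
Proof using sm.
rewrite /cm_type => -> ; case: xgetP => // k _ [K [q [q1 q2]] [P extP]] k1 mx rx.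
by move: extP; rewrite k1; move/(ext1_length_is sm mx rx P q1 q2).
Qed.

End TypeAndDepth.

(** * Finite injective dimension *)

Section SubmoduleType.
Variables (R : comNzRingType) (V : lmodType R) (N : set V) (sN : submodule N).

(** The proof that [N] is a submodule is a parameter so that the closure properties can be
    attached to the predicate. *)
Definition submod_pred & submodule N : {pred V} := [in N].

HB.instance Definition _ := GRing.isSubmodClosed.Build R V (submod_pred sN)
  (GRing.submod_closed_semi sN).

Definition submod_type := {v : V | v \in submod_pred sN}.

HB.instance Definition _ := SubChoice.on submod_type.
HB.instance Definition _ := [SubChoice_isSubLmodule of submod_type by <:].

End SubmoduleType.

Section InjectiveModules.
Variables (R : comNzRingType) (m : set R) (x : R).
Hypotheses (R_noeth : noetherian R) (R_local : local_ring m).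
Hypothesis R_dim1 : krull_dim R^o = 1%N.
Hypotheses (mx : m x) (rx : regular_on R^o x).

(** Injectivity applied to the inclusion of [I] in [R]. *)
Lemma baer_extension (E : lmodType R) (I : set R^o) (h : R -> E) :
  injective_module E -> submodule I ->
  (forall a u v, I u -> I v -> h (a * u + v) = a *: h u + h v) ->
  exists e, forall i, I i -> h i = i *: e.
Proof using Type.
move=> Einj sI hlin; pose U : lmodType R := submod_type sI.
have g_lin : linear (fun u : U => val u : R^o) by [].
have h_lin : linear (fun u : U => h (val u)).
  by move=> a u v; apply: hlin; apply/set_mem/valP.
have g_inj : injective (linear_of g_lin) by exact: val_inj.
have [h' h'E] := Einj _ _ (linear_of g_lin) (linear_of h_lin) g_inj.
exists (h' (1 : R^o)) => i Ii; have /mem_set pi := Ii.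
have /= <- := h'E (exist _ (i : R^o) pi : U).
by rewrite -linearZ /= /GRing.scale /= mulr1.
Qed.

Lemma injective_divisible (E : lmodType R) (e : E) : injective_module E ->
  exists e', x *: e' = e.
Proof using rx.
move=> Einj.
have g_lin := scale_linear (M := R^o) x.
have h_lin : linear (fun r : R^o => r *: e) by move=> a u v; rewrite scalerDl scalerA.
have [h hE] := Einj _ _ (linear_of g_lin) (linear_of h_lin) (fun u v => @regular_inj _ _ _ u v rx).
exists (h (1 : R^o)); rewrite -linearZ; have /= := hE (1 : R^o); rewrite scale1r; exact.
Qed.

(** A fragment of injectivity that passes from [Z] to earlier cosyzygies: the homomorphism
    [J + R a -> Z] that vanishes on [J] and sends [a] to [w] extends to [R]. Here [J] contains the
    regular element [x] and [J + R a] is a simple step above [J]. It is a property of a subset of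
    [E], as the cosyzygies are kernels of the differentials. *)
Definition extends_simple (E : lmodType R) (Z : set E) : Prop :=
  forall (J : set R^o) (a : R) (w : E), submodule J -> J x -> ~ J a ->
    (forall b, m b -> J (b * a)) -> Z w -> (forall b, m b -> b *: w = 0) ->
    exists v, [/\ Z v, forall j, J j -> j *: v = 0 & a *: v = w].

Lemma injective_extends_simple (E : lmodType R) : injective_module E ->
  extends_simple [set: E].
Proof using R_noeth R_local.
move=> Einj J a w sJ _ Ja ma _ mw; have sI := submod_adjoin (a : R^o) sJ.
have hex i : exists r, adjoin J (a : R^o) i -> J (i - r * a).
  have [[j [_ [Jj [r ->] ->]]]|ni] := pselect (adjoin J (a : R^o) i); last by exists 0 => /ni.
  by exists r => _; rewrite addrK.
pose h i := sval (cid (hex i)) *: w.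
have hE i r : J (i - r * a) -> adjoin J (a : R^o) i -> h i = r *: w.
  move=> Jr /(svalP (cid (hex i))); rewrite /h; set s := sval _ => Js.
  apply/eqP; rewrite -subr_eq0 -scalerBl; apply/eqP/mw; apply: contrapT => nm; apply: Ja.
  have [c cE] := inverse_notin_m R_noeth R_local nm.
  have -> : a = c * ((i - r * a) - (i - s * a)).
    by rewrite -[LHS]mul1r -cE; ring.
  by apply: (submodZ c sJ); exact: (submodB sJ).
have [|v vE] := baer_extension Einj sI (h := h).
  move=> b u v Iu Iv; rewrite (hE _ _ (svalP (cid (hex u)) Iu) Iu) (hE _ _ (svalP (cid (hex v)) Iv) Iv).
  set r := sval _; set s := sval _; rewrite scalerA -scalerDl; apply: hE; last first.
    by apply: (submodD sI) => //; exact: (submodZ b sI).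
  have -> : b * u + v - (b * r + s) * a = b * (u - r * a) + (v - s * a) by ring.
  apply: (submodD sJ); last exact: (svalP (cid (hex v)) Iv).
  by apply: (submodZ b sJ); exact: (svalP (cid (hex u)) Iu).
exists v; split=> // [j Jj|].
  have Ij : adjoin J (a : R^o) j by exact: sub_adjoin.
  by rewrite -vE // (hE j 0) ?scale0r // mul0r subr0.
have Ia : adjoin J (a : R^o) a by exact: adjoin_self.
by rewrite -vE // (hE a 1) ?scale1r // mul1r subrr; exact: (submod0 sJ).
Qed.

(** One step down an injective resolution. The kernel [Z] of [d] is divisible by [x], being a
    quotient of an injective module, so elements of the image of [d] that are killed by [x] lift
    to elements killed by [x]. As [R / m] embeds in [R / xR], the same holds with [m] in place of
    [x], and then with any ideal [I] containing [x], by Noetherian induction on [I]: this is the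
    vanishing of [Ext^1 (R/I, Z)]. *)
Section Cosyzygy.
Variables (E E' : lmodType R) (d : {linear E -> E'}).
Hypothesis E_ext : extends_simple [set: E].
Hypothesis Z'_ext : extends_simple (range d).
Hypothesis Z_div : forall z, d z = 0 -> exists2 z', d z' = 0 & x *: z' = z.

Lemma lift_annihilated_by_m (u : E') : range d u -> (forall b, m b -> b *: u = 0) ->
  exists2 e, (forall b, m b -> b *: e = 0) & d e = u.
Proof using All.
move=> du mu.
have x1 : ~ line (x : R^o) 1.
  move=> [r r1]; apply: (notin_m1 R_local); rewrite r1; exact: (submodZ r (submod_m R_local)).
have [s [xs ms]] := ring_socle R_noeth R_local R_dim1 rx (submod_line _) (line_self (x : R^o)) x1.
have [_ [[v _ <-] xv sv]] := Z'_ext (submod_line (x : R^o)) (line_self (x : R^o)) xs ms du mu.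
have [z dz xz] : exists2 z, d z = 0 & x *: z = x *: v.
  by apply: Z_div; rewrite linearZ; apply: xv; exact: line_self.
exists (s *: (v - z)); last by rewrite linearZ linearB /= dz subr0.
move=> b /ms[r bs]; rewrite scalerA.
have -> : b * s = r * x by exact: bs.
by rewrite -scalerA scalerBr xz subrr scaler0.
Qed.

Lemma lift_annihilated (I : set R^o) (u : E') : submodule I -> I x ->
  range d u -> (forall b, I b -> b *: u = 0) ->
  exists2 e, (forall b, I b -> b *: e = 0) & d e = u.
Proof using All.
move=> sI Ix; move: u.
pose lifts (J : set R^o) := forall u : E', range d u -> (forall b, J b -> b *: u = 0) ->
  exists2 e, (forall b, J b -> b *: e = 0) & d e = u.
suff : lifts I by []; apply: contrapT => nI.
have [J [sJ nJ IJ Jmax]] := @maximal_among _ R_noeth (fun J => ~ lifts J) _ sI nI.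
apply: nJ; have [J1|J1] := pselect (J 1).
  move=> u _ Ju; exists 0; first by move=> b _; rewrite scaler0.
  by rewrite linear0 -[u]scale1r Ju.
have Jx : J x by exact: IJ.
have [a [Ja ma]] := ring_socle R_noeth R_local R_dim1 rx sJ Jx J1.
have sK := submod_adjoin (a : R^o) sJ.
have liftK : lifts (adjoin J (a : R^o)).
  apply: contrapT => nK; apply: Ja.
  rewrite -(Jmax _ sK _ nK); [exact: adjoin_self|exact: sub_adjoin].
move=> u du Ju.
have dau : range d (a *: u) by case: du => e _ <-; exists (a *: e) => //; rewrite linearZ.
have mau b : m b -> b *: (a *: u) = 0 by move=> mb; rewrite scalerA; apply/Ju/ma.
have [w mw dw] := lift_annihilated_by_m dau mau.
have [y [_ Jy ay]] := E_ext sJ Jx Ja ma Logic.I mw.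
have [|c Kc|e Ke de] := liftK (u - d y).
- by case: du => e _ <-; exists (e - y) => //; rewrite linearB.
- case: Kc => j [_ [Jj [r ->] cE]]; have {cE}-> : c = j + r * a := cE.
  rewrite scalerBr -linearZ !scalerDl Jy // Ju // !add0r.
  by rewrite -!scalerA ay [d (r *: w)]linearZ dw subrr.
exists (e + y); last by rewrite linearD de subrK.
by move=> b Jb; rewrite scalerDr Jy // addr0; apply: Ke; exact: sub_adjoin.
Qed.

Lemma cosyzygy_extends : extends_simple [set z | d z = 0].
Proof using All.
move=> J a w sJ Jx Ja ma dw mw.
have [v [_ Jv av]] := E_ext sJ Jx Ja ma Logic.I mw.
have sK := submod_adjoin (a : R^o) sJ.
have [||c Kc|e Ke de] := @lift_annihilated _ (d v) sK.
- exact: sub_adjoin.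
- by exists v.
- case: Kc => j [_ [Jj [r ->] cE]]; have {cE}-> : c = j + r * a := cE.
  by rewrite scalerDl -linearZ Jv // linear0 add0r -scalerA (_ : a *: d v = 0) ?scaler0 // -linearZ av.
exists (v - e); split.
- by rewrite /= linearB de subrr.
- by move=> j Jj; rewrite scalerBr Jv // Ke ?subr0 //; exact: sub_adjoin.
- by rewrite scalerBr Ke ?subr0 //; exact: adjoin_self.
Qed.

End Cosyzygy.

(** Descending induction: far enough in the resolution everything vanishes. *)
Lemma cosyzygies_extend (W : lmodType R) (E : injective_resolution W) n :
  (forall i, (n <= i)%N -> forall e : ir_mod E i, e = 0) ->
  forall i, extends_simple [set z | ir_diff E i.+1 z = 0].
Proof using All.
move=> En0.
suff H k i : (n <= i + k)%N -> extends_simple [set z | ir_diff E i.+1 z = 0].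
  by move=> i; apply: (H n); exact: leq_addl.
elim: k i => [|k IH] i.
  rewrite addn0 => ni J a w _ _ _ _ _ _; exists 0; split.
  - by rewrite /= linear0.
  - by move=> j _; rewrite scaler0.
  - by rewrite scaler0 [RHS](En0 i.+1) // leqW.
rewrite addnS -addSn => /IH ext; apply: cosyzygy_extends.
- exact/injective_extends_simple/ir_injective.
- by rewrite ir_exactS.
- move=> z dz; have : [set v | ir_diff E i.+1 v = 0] z by [].
  rewrite -ir_exactS => -[e _ <-].
  have [e' <-] := injective_divisible e (@ir_injective _ _ E i).
  exists (ir_diff E i e'); last by rewrite linearZ.
  by have : range (ir_diff E i) (ir_diff E i e') by [exists e']; rewrite ir_exactS.
Qed.

(** A homomorphism [J -> W] is multiplication by some [v] in the first injective module, and is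
    also given by [y / x] with [y] in [(xW : J)]. If all of them extended to [J + R a], then
    [Ext^1 (R/m, W)] would inject in [Ext^1 ((J + R a), W)], which vanishes; but [v0] represents a
    nonzero class. *)
Lemma residual_strict (W : lmodType R) (v0 : W) : finite_injective_dimension W ->
  regular_on W x ->
  residual m [set: W] (homothety x [set: W]) v0 -> ~ homothety x [set: W] v0 ->
  forall (J : set R^o) (a : R), submodule J -> J x -> ~ J a ->
  (forall b, m b -> J (b * a)) ->
  exists y : W, (forall j, J j -> homothety x [set: W] (j *: y)) /\
    ~ homothety x [set: W] (a *: y).
Proof using All.
move=> [E [n En0]] rxW [_ mv0] xv0 J a sJ Jx Ja ma.
pose aug := ir_aug E; pose d := ir_diff E 0.
have d_aug w : d (aug w) = 0.
  by have : range aug (aug w) by [exists w]; rewrite /aug ir_exact0.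
have aug_ex e : d e = 0 -> exists w, aug w = e.
  move=> de; have : [set v | d v = 0] e by [].
  by rewrite /d -ir_exact0 => -[w _ <-]; exists w.
have h_ex b : exists w, m b -> b *: v0 = x *: w.
  have [/mv0[w _ wE]|nb] := pselect (m b); first by exists w.
  by exists 0 => /nb.
pose h b := sval (cid (h_ex b)).
have hP b : m b -> b *: v0 = x *: h b := svalP (cid (h_ex b)).
have [|e eE] := baer_extension (h := aug \o h) (@ir_injective _ _ E 0) (submod_m R_local).
  move=> b u v mu mv; rewrite /= -linearZ -linearD; congr (aug _); apply: (regular_inj rxW).
  have mbuv : m (b * u + v).
    by apply: (submodD (submod_m R_local)) => //; exact: (submodZ b (submod_m R_local)).
  by rewrite -hP // scalerDl scalerDr -hP // -scalerA hP // !scalerA mulrC.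
have {}eE b : m b -> aug (h b) = b *: e by move/eE.
pose u := d e.
have mu b : m b -> b *: u = 0 by move=> mb; rewrite -linearZ -eE.
have no_lift e' : (forall b, m b -> b *: e' = 0) -> d e' = u -> False.
  move=> me' de'; have [w wE] : exists w, aug w = e - e'.
    by apply: aug_ex; rewrite linearB /= de' subrr.
  apply: xv0; exists w => //.
  have -> : v0 = h x by apply: (regular_inj rxW); exact: hP.
  apply: (@ir_inj _ _ E); rewrite linearZ /= -/aug eE // wE.
  by rewrite scalerBr me' // subr0.
have du : [set z | ir_diff E 1 z = 0] u by rewrite -ir_exactS; exists e.
have [v' [Zv Jv av]] := cosyzygies_extend En0 (i := 0%N) sJ Jx Ja ma du mu.
have [v vE] : exists v, d v = v'.
  by move: Zv; rewrite -ir_exactS => -[v _ <-]; exists v.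
have w_ex j : exists w, J j -> aug w = j *: v.
  have [Jj|nj] := pselect (J j); last by exists 0 => /nj.
  have [w wE] : exists w, aug w = j *: v by apply: aug_ex; rewrite linearZ /= vE Jv.
  by exists w.
pose w j := sval (cid (w_ex j)).
have wE j : J j -> aug (w j) = j *: v := svalP (cid (w_ex j)).
have yE : aug (w x) = x *: v := wE x Jx.
exists (w x); split=> [j Jj|[w' _ aw']].
  exists (w j) => //; apply: (@ir_inj _ _ E).
  by rewrite !linearZ /= -/aug (wE j Jj) yE !scalerA mulrC.
apply: (no_lift (a *: v - aug w')); last by rewrite linearB linearZ /= vE av d_aug subr0.
move=> b mb; rewrite scalerBr scalerA -wE; last exact: ma.
rewrite -linearZ -linearB; have -> : w (b * a) = b *: w'; last by rewrite subrr linear0.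
apply: (regular_inj rxW); apply: (@ir_inj _ _ E).
have -> : x *: (b *: w') = b *: (a *: w x) by rewrite aw' !scalerA mulrC.
by rewrite !linearZ /= -/aug (wE _ (ma _ mb)) yE !scalerA mulrC.
Qed.

End InjectiveModules.

(** * Commensurability *)

Section Cofinal.
Variables (R : comNzRingType) (m : set R).
Hypotheses (R_noeth : noetherian R) (R_local : local_ring m).
Variables (M : lmodType R) (y : R).
Hypotheses (my : m y) (ry : regular_on M y).
Implicit Types (A B : set M).

Lemma finitely_generated_homothety a B :
  finitely_generated B -> finitely_generated (homothety a B).
Proof.
move=> [n /generated_byP[s sz ->]]; exists n; apply/generated_byP.
exists (map (fun u => a *: u) s); first by rewrite size_map.
elim: s {sz} => [|u s IH] /=.
  apply/seteqP; split=> [_ [_ -> ->]|_ ->]; first by rewrite scaler0.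
  by exists 0; rewrite ?scaler0.
apply/seteqP; split.
  move=> _ [_ [g [_ [gs [r ->] ->]]] ->]; rewrite scalerDr.
  exists (a *: g), (r *: (a *: u)); split; last by rewrite !scalerA mulrC.
    by rewrite -IH; exists g.
  by exists r.
apply: adjoin_min.
- exact/submod_homothety/(submod_gens (u :: s)).
- by rewrite -IH; apply: homothetyS; exact: sub_adjoin.
- by exists u => //; apply: adjoin_self; exact: submod_gens.
Qed.

Lemma len_second_iso A B : submodule A -> submodule B ->
  finite_length B (sums A B) -> len (A `&` B) A = len B (sums A B).
Proof.
move=> sA sB fl; apply: (len_transfer (f := id)) => //.
- exact: submodI.
- exact: submod_sums.
- exact: sums_right.
- by move=> v; exact: sums_left.
- by move=> v Av; split=> [|[]].
- move=> w [a [b [Aa Bb ->]]]; exists a => //.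
  by rewrite addrAC subrr add0r.
Qed.

(** If [B / y^n B] is not longer than [A / y^n A] for any [n], then [A] contains some [y^n B]. The
    quotients [B / (A + y^n B)] are not longer than the [y]-torsion part of [B / A], a finite
    length that does not depend on [n]; so [A + y^n B] is stationary, and Nakayama's lemma
    applies. *)
Lemma cofinal A B : submodule A -> submodule B -> A `<=` B -> acc A B ->
  finitely_generated B ->
  (forall n, finite_length (homothety (y ^+ n) A) A) ->
  (forall n, finite_length (homothety (y ^+ n) B) B) ->
  (forall n, len (homothety (y ^+ n) B) B <= len (homothety (y ^+ n) A) A)%N ->
  exists n, homothety (y ^+ n) B `<=` A.
Proof using All.
move=> sA sB AB accAB fgB fA fB le.
pose A' n := [set v | B v /\ A (y ^+ n *: v)].
have sA' n : submodule (A' n).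
  apply/submoduleP; split; first by split; [exact: submod0|rewrite scaler0; exact: submod0].
  move=> a u v [Bu Au] [Bv Av]; split; first by apply: submodD => //; exact: submodZ.
  rewrite scalerDr scalerA mulrC -scalerA; apply: submodD => //; exact: submodZ.
have AA' n : A `<=` A' n by move=> v Av; split; [exact: AB|exact: submodZ].
have A'B n : A' n `<=` B by move=> v [].
have A'S n : A' n `<=` A' n.+1.
  by move=> v [Bv Av]; split=> //; rewrite exprS -scalerA; exact: submodZ.
have [k kP] := accAB _ (fun n => And3 (sA' n) (@AA' n) (@A'B n)) A'S.
pose b := len A (A' k).
have ryn n : regular_on M (y ^+ n) by exact: regular_exp.
have fA' n : finite_length A (A' n).
  apply/(len_homothety (ryn n) sA (sA' n) (AA' n)).1.
  apply: finite_length_sub (fA n) => //; first exact: submod_homothety.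
    by apply: homothetyS.
  by move=> _ [v [_ Av] ->].
have le_b n : (len A (A' n) <= b)%N.
  have [nk|kn] := leqP n k; last by rewrite kP // ltnW.
  have sub := ascending_le A'S nk.
  by rewrite /b (lenD sA (sA' n) (sA' k) (AA' n) sub (fA' k)) leq_addr.
pose S n := sums A (homothety (y ^+ n) B).
have syB n : submodule (homothety (y ^+ n) B) by exact: submod_homothety.
have syA n : submodule (homothety (y ^+ n) A) by exact: submod_homothety.
have sS n : submodule (S n) by exact: submod_sums.
have SB n : S n `<=` B by apply: sums_min => //; exact: homothety_sub.
have ySn n : homothety (y ^+ n) B `<=` S n by exact: sums_right.
have fS n : finite_length (S n) B by apply: finite_length_sub (fB n).
have S_le n : (len (S n) B <= b)%N.
  have IE : A `&` homothety (y ^+ n) B = homothety (y ^+ n) (A' n).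
    apply/seteqP; split=> [w [Aw [v Bv wE]]|_ [v [Bv Av] ->]]; last by split=> //; exists v.
    by exists v => //; split=> //; rewrite -wE.
  have yAI : homothety (y ^+ n) A `<=` A `&` homothety (y ^+ n) B.
    by rewrite IE; exact: homothetyS.
  have := le n; rewrite (lenD (syB n) (sS n) sB (@ySn n) (@SB n) (fB n)).
  rewrite (lenD (syA n) (submodI sA (syB n)) sA yAI (@subIsetl _ _ _) (fA n)).
  rewrite (len_second_iso sA (syB n)); last first.
    exact: (finite_length_sub (syB n) (@subset_refl _ _) (@ySn n) (@SB n) (fB n)).
  rewrite addnC leq_add2r => /leq_trans; apply.
  by rewrite IE (len_homothety (ryn n) sA (sA' n) (AA' n)).2.
have SS n : S n.+1 `<=` S n.
  apply: sums_min => //; first exact: sums_left.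
  move=> _ [v Bv ->]; apply: ySn; exists (y *: v); first exact: submodZ.
  by rewrite exprSr scalerA.
have [n nP] : exists n, S n `<=` S n.+1.
  apply: contrapT => nS.
  have h n : (n <= len (S n) B)%N.
    elim: n => // n IH; rewrite (lenD (sS n.+1) (sS n) sB (@SS n) (@SB n) (fS _)).
    rewrite -add1n leq_add // lt0n; apply/eqP => l0; apply: nS; exists n.
    have <- := len_eq0 (sS n.+1) (sS n) (@SS n) _ l0; first by [].
    exact: finite_length_sub (fS n.+1).
  by have := leq_trans (h b.+1) (S_le b.+1); rewrite ltnn.
exists n; apply: (nakayama R_noeth R_local sA); first exact: finitely_generated_homothety.
apply: subset_trans (@ySn n) _; apply: subset_trans nP _.
apply: sums_min; first by apply: submod_sums => //; exact: submod_smul.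
  by apply: sums_left; exact: submod_smul.
move=> _ [v Bv ->]; apply: sums_right => //.
by rewrite exprS -scalerA; apply: smul_in => //; exists v.
Qed.

End Cofinal.

(** * Duality for modules of type one *)

(** The pairing [R / yR x N / yN -> N / yN]. Multiplication by a generator of a simple step embeds
    the corresponding jump of either orthogonal in the socle [(yN : m) / yN], whose length is
    one. *)
Section TypeOne.
Variables (R : comNzRingType) (m : set R).
Hypotheses (R_noeth : noetherian R) (R_local : local_ring m).
Variables (M : lmodType R) (N : set M) (y : R).
Hypotheses (sN : submodule N).

Let yN := homothety y N.
Let syN : submodule yN := submod_homothety y sN.
Let yR := homothety y [set: R^o].
Let syR : submodule yR := submod_homothety y (submodT _).

Hypothesis type1 : length_is yN (residual m N yN) 1.

Definition perp (J : set R^o) : set M := residual J N yN.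

Definition coperp (K : set M) : set R^o := [set a | forall v, K v -> yN (a *: v)].

Lemma submod_residual (J : set R) : submodule (residual J N yN).
Proof using sN.
apply/submoduleP; split.
  by split=> [|b _]; [exact: submod0|rewrite scaler0; exact: submod0].
move=> a u v [Nu hu] [Nv hv]; split=> [|b Jb]; first by apply: submodD => //; exact: submodZ.
rewrite scalerDr scalerA mulrC -scalerA; apply: submodD => //; last exact: hv.
by apply: submodZ => //; exact: hu.
Qed.

Lemma submod_coperp (K : set M) : submodule (coperp K).
Proof using sN.
apply/submoduleP; split=> [v _|a b c hb hc v Kv]; first by rewrite scale0r; exact: submod0.
rewrite scalerDl -scalerA; apply: submodD => //; last exact: hc.
by apply: submodZ => //; exact: hb.
Qed.

Lemma perpS (J I : set R^o) : J `<=` I -> perp I `<=` perp J.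
Proof. by move=> JI v [Nv h]; split=> // b /JI; exact: h. Qed.

Lemma coperpS (K K' : set M) : K `<=` K' -> coperp K' `<=` coperp K.
Proof. by move=> KK' a h v /KK'; exact: h. Qed.

Lemma perp_len (J I : set R^o) : submodule J -> submodule I -> J `<=` I ->
  finite_length J I ->
  finite_length (perp I) (perp J) /\ (len (perp I) (perp J) <= len J I)%N.
Proof using R_noeth R_local type1 sN.
move=> sJ sI JI fl; apply: (antitone_len_le R_noeth R_local sJ sI JI fl).
- by move=> K _; exact: submod_residual.
- exact: perpS.
move=> K u sK JK KI Iu Ku mu.
have lin := scale_linear (M := M) (u : R).
have := @len_embed _ _ _ _ lin (perp (adjoin K u)) (perp K) yN (residual m N yN).
rewrite (lenE type1); apply.
- exact: submod_residual.
- exact: submod_residual.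
- exact: syN.
- exact: submod_residual.
- by apply: perpS; exact: sub_adjoin.
- by move=> _ [v Nv ->]; split=> [|b _]; [exact: submodZ|apply: submodZ => //; exists v].
- move=> v [Nv Kv]; split=> [|b mb]; first exact: submodZ.
  by rewrite scalerA; exact/Kv/mu.
- move=> v [Nv Kv]; split=> [yuv|[_ h]]; last by apply: h; exact: adjoin_self.
  split=> // c [k [_ [Kk [r ->] cE]]]; have {cE}-> : c = k + r * u := cE.
  rewrite scalerDl -scalerA; apply: submodD => //; first exact: Kv.
  exact: submodZ.
- by exists 1%N.
Qed.

Lemma coperp_len (K K' : set M) : submodule K -> submodule K' -> K `<=` K' -> K' `<=` N ->
  finite_length K K' ->
  finite_length (coperp K') (coperp K) /\ (len (coperp K') (coperp K) <= len K K')%N.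
Proof using R_noeth R_local type1 sN.
move=> sK sK' KK' K'N fl; apply: (antitone_len_le R_noeth R_local sK sK' KK' fl).
- by move=> D _; exact: submod_coperp.
- exact: coperpS.
move=> D u sD KD DK' K'u Du mu.
have lin : linear (fun a : R^o => (a : R) *: u).
  by move=> a v w; rewrite scalerDl -scalerA.
have := @len_embed _ _ _ _ lin (coperp (adjoin D u)) (coperp D) yN (residual m N yN).
rewrite (lenE type1); apply.
- exact: submod_coperp.
- exact: submod_coperp.
- exact: syN.
- exact: submod_residual.
- by apply: coperpS; exact: sub_adjoin.
- by move=> _ [v Nv ->]; split=> [|b _]; [exact: submodZ|apply: submodZ => //; exists v].
- move=> a ha; split=> [|b mb]; first by apply: submodZ => //; exact: K'N.
  by rewrite scalerA mulrC -scalerA; exact/ha/mu.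
- move=> a ha; split=> [yau|h]; last by apply: h; exact: adjoin_self.
  move=> _ [v [_ [Dv [r ->] ->]]]; rewrite scalerDr; apply: submodD => //; first exact: ha.
  by rewrite scalerA mulrC -scalerA; exact: submodZ.
- by exists 1%N.
Qed.

Lemma perp_top : perp [set: R^o] = yN.
Proof using sN.
apply/seteqP; split=> [v [_ /(_ 1 I)]|_ [v Nv ->]]; first by rewrite scale1r.
by split=> [|b _]; [exact: submodZ|apply: submodZ => //; exists v].
Qed.

Lemma perp_bottom : perp yR = N.
Proof using sN.
apply/seteqP; split=> [v []//|v Nv]; split=> // _ [r _ ->].
by exists (r *: v); [exact: submodZ|rewrite scalerA].
Qed.

Lemma type1_len_le : finite_length yR [set: R^o] ->
  finite_length yN N /\ (len yN N <= len yR [set: R^o])%N.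
Proof using R_noeth R_local type1 sN.
move=> fl; have := perp_len syR (submodT _) (@subsetT _ _) fl.
by rewrite perp_top perp_bottom.
Qed.

End TypeOne.

(** * Canonical ideals *)

Section Injection.
Variables (R : comNzRingType) (V W : lmodType R) (f : {linear V -> W}).
Hypothesis f_inj : injective f.

Lemma len_range (y : R) l :
  length_is (homothety y [set: V]) [set: V] l <->
  length_is (homothety y (range f)) (range f) l.
Proof using f_inj.
have sr : submodule (range f) by apply: submod_image (submodT _) => a u v; exact: linearP.
apply: (@length_is_transfer R V W f) => //.
- by move=> a u v; exact: linearP.
- exact: submod_homothety (submodT _).
- exact: submodT.
- exact: submod_homothety.
- exact: homothety_sub.
- move=> v _; split=> [[_ [w _ <-]]|[w _ ->]]; last by exists (f w); [exists w|rewrite linearZ].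
  by rewrite -linearZ => /f_inj ->; exists w.
- by move=> _ [v _ <-]; exists v => //; rewrite subrr; exact: (submod0 (submod_homothety _ sr)).
Qed.

Lemma type_range (m : set R) (y : R) l :
  length_is (homothety y [set: V]) (residual m [set: V] (homothety y [set: V])) l <->
  length_is (homothety y (range f)) (residual m (range f) (homothety y (range f))) l.
Proof using f_inj.
have sr : submodule (range f) by apply: submod_image (submodT _) => a u v; exact: linearP.
have fE v : homothety y (range f) (f v) <-> homothety y [set: V] v.
  split=> [[_ [w _ <-]]|[w _ ->]]; last by exists (f w); [exists w|rewrite linearZ].
  by rewrite -linearZ => /f_inj ->; exists w.
apply: (@length_is_transfer R V W f) => //.
- by move=> a u v; exact: linearP.
- exact: submod_homothety (submodT _).
- exact: (submod_residual _ (submodT _)).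
- exact: submod_homothety.
- exact: submod_residual.
- by move=> _ [v _ ->]; split=> // b _; apply: submodZ; [exact: submod_homothety (submodT _)|exists v].
- move=> _ [v rv ->]; split; first exact: submodZ.
  by move=> b _; apply: submodZ; [exact: submod_homothety|exists v].
- by move=> v [_ h]; split=> [|b mb]; [exists v|rewrite -linearZ; apply/fE/h].
- move=> _ [[v _ <-] h]; exists v; last by rewrite subrr; exact: (submod0 (submod_homothety _ sr)).
  by split=> // b mb; apply/fE; rewrite linearZ; exact: h.
Qed.

Lemma regular_range (y : R) : regular_on W y -> regular_on V y.
Proof using f_inj.
by move=> ry v yv; apply: f_inj; rewrite linear0; apply: ry; rewrite -linearZ yv linear0.
Qed.

End Injection.

Section CanonicalIdeals.
Variables (R : comNzRingType) (m : set R).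
Hypotheses (R_noeth : noetherian R) (R_local : local_ring m).
Hypothesis R_dim1 : krull_dim R^o = 1%N.

Let sm := submod_m R_local.

(** The properties of a canonical ideal that do not mention its injective dimension. They
    characterize canonical ideals, and the duality theory rests on them alone. *)
Definition type_one_ideal (C : set R^o) : Prop :=
  [/\ submodule C,
      exists c : R, [/\ C c, m c & regular_on R^o c] &
      forall y : R, m y -> regular_on R^o y ->
        length_is (homothety y C) (residual m C (homothety y C)) 1].

Lemma exp_in_m (x : R) n : m x -> m (x ^+ n.+1).
Proof using R_local. by move=> mx; rewrite exprSr; exact: (submodZ _ sm). Qed.

Lemma finite_homothety (y : R) : regular_on R^o y ->
  finite_length (homothety y [set: R^o]) [set: R^o].
Proof using R_noeth R_local R_dim1.
move=> ry; apply: (finite_colength R_noeth R_local R_dim1 ry).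
  exact: submod_homothety (submodT _).
by exists (1 : R^o) => //; rewrite /GRing.scale /= mulr1.
Qed.

(** Compute the length of [R / yK] through [K] and through [yR]. *)
Lemma len_mod_regular (K : set R^o) (y : R) : regular_on R^o y -> submodule K ->
  finite_length K [set: R^o] -> finite_length (homothety y K) [set: R^o] /\
  len (homothety y K) K = len (homothety y [set: R^o]) [set: R^o].
Proof using R_noeth R_local R_dim1.
move=> ry sK fK; have syK := submod_homothety y sK.
have syR := submod_homothety y (submodT R^o).
have [hf hl] := len_homothety ry sK (submodT _) (@subsetT _ _).
have KR : homothety y K `<=` homothety y [set: R^o] := homothetyS (@subsetT _ _).
have [f1 e1] := finite_length_add syK syR (submodT _) KR (@subsetT _ _)
  (iffRL hf fK) (finite_homothety ry).
split=> //; have := lenD syK sK (submodT _) (homothety_sub sK) (@subsetT _ _) f1.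
by rewrite e1 hl addnC => /addIn.
Qed.

(** The point is that the image contains a regular element. By [residual_strict], [W / x^n W] is
    at least as long as [R / x^n R], so that [cofinal] applies to [range f] inside [R]. *)
Lemma canonical_ideal_type_one (W : lmodType R) (f : {linear W -> R^o}) (x : R) :
  m x -> regular_on R^o x -> canonical_module m W -> injective f ->
  type_one_ideal (range f).
Proof using R_noeth R_local R_dim1.
move=> mx rx [[_ _ dW kW] tW finj] f_inj; rewrite kW R_dim1 in dW.
have sC : submodule (range f) by apply: submod_image (submodT _) => a u v; exact: linearP.
have type1 y : m y -> regular_on R^o y ->
    length_is (homothety y [set: W]) (residual m [set: W] (homothety y [set: W])) 1.
  move=> my ry; apply: (cm_type1_socle sm) => //; exact: (regular_range f_inj ry).
split=> // [|y my ry]; last by apply/type_range => //; exact: type1.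
have fin n : finite_length (homothety (x ^+ n) [set: W]) [set: W] /\
    len (homothety (x ^+ n) [set: R^o]) [set: R^o] = len (homothety (x ^+ n) [set: W]) [set: W].
  case: n => [|n]; first by rewrite expr0 !homothety1 !(len_refl (submodT _)).2; split=> //; exact: (len_refl (submodT _)).1.
  have my := exp_in_m n mx; have ry := @regular_exp _ _ _ n.+1 rx.
  move: (x ^+ n.+1) my ry => y my ry.
  have ryW := regular_range f_inj ry.
  have fR := finite_homothety ry.
  have [fW le] := type1_len_le R_noeth R_local (submodT _) (type1 y my ry) fR.
  split=> //; apply/eqP; rewrite eqn_leq le andbT.
  have [v0 [rv0 yv0]] : exists v0, residual m [set: W] (homothety y [set: W]) v0 /\
      ~ homothety y [set: W] v0.
    apply: contrapT => nv; have := lenE (type1 y my ry).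
    have -> : residual m [set: W] (homothety y [set: W]) = homothety y [set: W].
      apply/seteqP; split=> v; first by move=> rv; apply: contrapT => yv; apply: nv; exists v.
      by move=> yv; split=> // b _; apply: submodZ => //; exact: submod_homothety (submodT _).
    by rewrite (len_refl (submod_homothety _ (submodT _))).2.
  apply: chain_le_len => //.
  rewrite -[X in chain_between X](perp_top y (submodT W)).
  rewrite -[X in chain_between _ X](perp_bottom y (submodT W)).
  have syR := submod_homothety y (submodT R^o).
  apply: (antitone_chain R_noeth R_local syR (submodT _) (@subsetT _ _) fR).
  - by move=> K _; exact: (submod_residual _ (submodT _)).
  - exact: perpS.
  move=> K u sK yK _ _ Ku mu sub.
  have Ky : K y by apply: yK; exists (1 : R^o) => //; rewrite /GRing.scale /= mulr1.
  have [w [Kw uw]] := residual_strict R_noeth R_local R_dim1 my ry finj ryW rv0 yv0 sK Ky Ku mu.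
  have [_ h] : perp [set: W] y (adjoin K u) w by apply: sub; split.
  by apply: uw; apply: h; exact: adjoin_self.
have fC n : finite_length (homothety (x ^+ n) (range f)) (range f) /\
   len (homothety (x ^+ n) (range f)) (range f) = len (homothety (x ^+ n) [set: W]) [set: W].
  have [/lenP h _] := fin n; move/(len_range f_inj): h => h.
  by split; [exists (len (homothety (x ^+ n) [set: W]) [set: W])|exact: lenE].
have [|||||n sub] := cofinal R_noeth R_local mx rx sC (submodT R^o) (@subsetT _ _).
- by apply: acc_sub (noetherian_acc R_noeth) => _ ->; exact: (submod0 sC).
- exact: ring_finitely_generated.
- by move=> n; exact: (fC n).1.
- by move=> n; apply: finite_homothety; exact: regular_exp.
- by move=> n; rewrite (fC n).2 (fin n).2.
exists (x ^+ n.+1); split; last exact: regular_exp.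
  rewrite exprS; apply: (submodZ x sC); apply: sub; exists (1 : R^o) => //.
  by rewrite /GRing.scale /= mulr1.
exact: exp_in_m.
Qed.

End CanonicalIdeals.

Section Duality.
Variables (R : comNzRingType) (m : set R).
Hypotheses (R_noeth : noetherian R) (R_local : local_ring m).
Hypothesis R_dim1 : krull_dim R^o = 1%N.

Let sm := submod_m R_local.

(** [W / y^n W] is at most as long as [R / y^n R] because [W] has type one, so [cofinal] gives
    [z = y ^+ n] with [z W] inside the image of [R]; then [g] is multiplication by [z]. *)
Lemma canonical_over_ring (W : lmodType R) (j : {linear R^o -> W}) :
  canonical_module m W -> injective j ->
  exists (g : {linear W -> R^o}) (z : R), [/\ injective g, regular_on R^o z,
    forall v, g v *: j (1 : R^o) = z *: v & type_one_ideal m (range g)].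
Proof using R_noeth R_local R_dim1.
move=> [[fgW _ dW kW] tW _] j_inj; rewrite kW R_dim1 in dW.
have [y my ryW] := depth1_regular dW.
have ry := regular_range j_inj ryW.
pose w := j (1 : R^o).
have jE (a : R) : j (a : R^o) = a *: w.
  by rewrite -linearZ /=; congr (j _); rewrite /GRing.scale /= mulr1.
have rangeE : range j = line w.
  by apply/seteqP; split=> [_ [a _ <-]|_ [r ->]]; exists a + exists r; rewrite ?jE.
have type1 n : length_is (homothety (y ^+ n.+1) [set: W])
    (residual m [set: W] (homothety (y ^+ n.+1) [set: W])) 1.
  by apply: (cm_type1_socle sm) => //; [exact: exp_in_m|exact: regular_exp].
have fin n : finite_length (homothety (y ^+ n) [set: W]) [set: W] /\
    (len (homothety (y ^+ n) [set: W]) [set: W] <=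
     len (homothety (y ^+ n) [set: R^o]) [set: R^o])%N.
  case: n => [|n].
    by rewrite expr0 !homothety1 !(len_refl (submodT _)).2; split=> //; exact: (len_refl (submodT _)).1.
  apply: (type1_len_le R_noeth R_local (submodT _) (type1 n)).
  by apply: (finite_homothety R_noeth R_local R_dim1); exact: regular_exp.
have fj n : length_is (homothety (y ^+ n) (range j)) (range j)
    (len (homothety (y ^+ n) [set: R^o]) [set: R^o]).
  apply/(len_range j_inj)/lenP; apply: (finite_homothety R_noeth R_local R_dim1).
  exact: regular_exp.
have sj : submodule (range j) by rewrite rangeE; exact: submod_line.
have [||||n sub] := cofinal R_noeth R_local my ryW sj (submodT W) (@subsetT _ _) _ fgW.
- apply: acc_sub (acc_finitely_generated R_noeth fgW) => _ ->; exact: (submod0 sj).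
- by move=> n; exists (len (homothety (y ^+ n) [set: R^o]) [set: R^o]).
- by move=> n; exact: (fin n).1.
- by move=> n; rewrite (lenE (fj n)); exact: (fin n).2.
pose z := y ^+ n.
have rzW : regular_on W z by exact: regular_exp.
have rz : regular_on R^o z by exact: regular_exp.
have wreg (a b : R) : a *: w = b *: w -> a = b by rewrite -!jE => /j_inj.
have gex v : exists a : R, a *: w = z *: v.
  have : range j (z *: v) by apply: sub; exists v.
  by rewrite rangeE => -[a ->]; exists a.
pose g v : R^o := sval (cid (gex v)).
have gE v : g v *: w = z *: v := svalP (cid (gex v)).
have g_lin : linear g.
  move=> a u v; have: g (a *: u + v) = a * g u + g v; last by [].
  by apply: wreg; rewrite gE scalerDl -scalerA !gE scalerDr !scalerA mulrC.
have g_inj : injective (linear_of g_lin).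
  by move=> u v /= guv; apply: (regular_inj rzW); rewrite -!gE guv.
exists (linear_of g_lin), z; split=> //; split.
- by apply: submod_image (submodT _) => a u v; exact: g_lin.
- exists (z * y); split; last exact: regular_mul.
    by exists (y *: w) => //=; apply: wreg; rewrite gE scalerA.
  exact: (submodZ z sm).
- move=> x mx rx; apply/(type_range g_inj); apply: (cm_type1_socle sm) => //.
  exact: (regular_range g_inj rx).
Qed.

Section TypeOneIdeal.
Variable C : set R^o.
Hypothesis C1 : type_one_ideal m C.

Let sC : submodule C. Proof. by case: C1. Qed.

Lemma finite_length_ideal (K : set R^o) (y : R) : regular_on R^o y ->
  submodule K -> homothety y C `<=` K -> finite_length K [set: R^o].
Proof using C1 R_noeth R_local R_dim1.
move=> ry sK yCK; have [_ [c [Cc _ rc]] _] := C1.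
apply: (finite_colength R_noeth R_local R_dim1 (regular_mul ry rc)) => //.
by apply: yCK; exists c.
Qed.

Section Element.
Variable y : R.
Hypotheses (my : m y) (ry : regular_on R^o y).

Let type1 : length_is (homothety y C) (residual m C (homothety y C)) 1.
Proof. by case: C1 => _ _; apply. Qed.

Let yR := homothety y [set: R^o].
Let syR : submodule yR := submod_homothety y (submodT _).
Let fR : finite_length yR [set: R^o] := finite_homothety R_noeth R_local R_dim1 ry.
Let syC : submodule (homothety y C) := submod_homothety y sC.

Lemma len_ideal : len (homothety y C) C = len yR [set: R^o].
Proof using C1 ry R_noeth R_local R_dim1.
apply: (len_mod_regular R_noeth R_local R_dim1 ry sC _).2.
by apply: (finite_length_ideal ry sC); exact: homothety_sub.
Qed.

(** [C : C = R], in the form [yC : C = yR]. *)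
Lemma coperp_self : coperp C y C = yR.
Proof using C1 my ry R_noeth R_local R_dim1.
set I := coperp C y C; have sI : submodule I := submod_coperp y sC C.
have yI : yR `<=` I.
  by move=> _ [r _ ->] v Cv; exists (r *: v); [exact: submodZ|rewrite scalerA].
have fI := finite_length_sub sI yI (@subsetT _ I) (@subset_refl _ _) fR.
have perpI : perp C y I = perp C y yR.
  rewrite perp_bottom //; apply/seteqP; split=> [v []//|v Cv]; split=> // b; exact.
have [_ ] := perp_len R_noeth R_local sC type1 sI (submodT _) (@subsetT _ _) fI.
rewrite perpI perp_bottom // perp_top // len_ideal.
rewrite (lenD syR sI (submodT _) yI (@subsetT _ _) fR) -{2}[len I _]add0n leq_add2r leqn0.
move/eqP => l0; apply/esym/(len_eq0 syR sI yI _ l0).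
by apply: finite_length_sub fR.
Qed.

(** Cut the interval from [yC] to [C] at [K] and [K']. On each piece the orthogonals have at most
    the right length, and in total they have the right length by [len_ideal] and
    [coperp_self]. *)
Lemma coperp_len_eq (K K' : set R^o) : submodule K -> submodule K' ->
  homothety y C `<=` K -> K `<=` K' -> K' `<=` C ->
  finite_length (coperp C y K') (coperp C y K) /\ len (coperp C y K') (coperp C y K) = len K K'.
Proof using C1 my ry R_noeth R_local R_dim1.
move=> sK sK' yK KK' K'C.
have fK : finite_length (homothety y C) C.
  by apply: finite_length_sub (finite_length_ideal ry syC (@subset_refl _ _)) => //; exact: homothety_sub.
have KC := subset_trans KK' K'C; have yK' := subset_trans yK KK'.
have f1 := finite_length_sub syC (@subset_refl _ _) yK KC fK.
have f2 := finite_length_sub sK yK KK' K'C fK.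
have f3 := finite_length_sub sK' yK' K'C (@subset_refl _ _) fK.
have [g1 l1] := coperp_len R_noeth R_local sC type1 syC sK yK KC f1.
have [g2 l2] := coperp_len R_noeth R_local sC type1 sK sK' KK' K'C f2.
have [g3 l3] := coperp_len R_noeth R_local sC type1 sK' sC K'C (@subset_refl _ _) f3.
split=> //; apply/eqP; rewrite eqn_leq l2 /=.
have sco D := submod_coperp y sC D.
have top : coperp C y (homothety y C) = [set: R^o].
  by apply/seteqP; split=> // a _ v yv; exact: submodZ.
have := len_ideal; rewrite -coperp_self -top.
have c1 := @coperpS _ _ C y _ _ yK; have c2 := @coperpS _ _ C y _ _ KK'.
have c3 := @coperpS _ _ C y _ _ K'C.
rewrite (lenD syC sK sC yK KC fK) (lenD sK sK' sC KK' K'C (finite_length_sub sK yK KC (@subset_refl _ _) fK)).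
have [g32 e32] := finite_length_add (sco _) (sco _) (sco _) c3 c2 g3 g2.
have c32 := subset_trans c3 c2.
have [g321 ->] := finite_length_add (sco _) (sco _) (sco _) c32 c1 g32 g1.
by rewrite e32 => e; move: l1 l2 l3 e; lia.
Qed.

Lemma coperp_inj (K K' : set R^o) : submodule K -> submodule K' ->
  homothety y C `<=` K -> K `<=` K' -> K' `<=` C ->
  coperp C y K `<=` coperp C y K' -> K = K'.
Proof using C1 my ry R_noeth R_local R_dim1.
move=> sK sK' yK KK' K'C h.
have [_] := coperp_len_eq sK sK' yK KK' K'C.
have -> : coperp C y K' = coperp C y K by apply/seteqP; split=> //; exact: coperpS.
rewrite (len_refl (submod_coperp y sC K)).2 => /esym l0.
apply: (len_eq0 sK sK' KK' _ l0).
apply: finite_length_sub (finite_length_ideal ry syC (@subset_refl _ _)) => //.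
Qed.

(** The type is the number of generators of [C], because [(yR : m)] is the orthogonal of [mC]. *)
Lemma type_eq_generators : finite_length (smul m C) C /\
  length_is yR (residual m [set: R^o] yR) (len (smul m C) C).
Proof using C1 my ry R_noeth R_local R_dim1.
have smC := submod_smul m C.
have ymC : homothety y C `<=` smul m C by move=> _ [v Cv ->]; exact: smul_in.
have mCC : smul m C `<=` C := smul_sub sC.
have [fl <-] := coperp_len_eq smC sC ymC mCC (@subset_refl _ _).
split; first by apply: finite_length_sub (finite_length_ideal ry smC ymC).
have -> : residual m [set: R^o] yR = coperp C y (smul m C).
  apply/seteqP; split=> [a [_ ha] v mv|a ha].
    have sN : submodule [set v : R^o | homothety y C (a *: v)].
      apply/submoduleP; split; first by rewrite /= scaler0; exact: submod0.
      move=> b u w /= hu hw; rewrite scalerDr scalerA mulrC -scalerA.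
      by apply: submodD => //; exact: submodZ.
    apply: (smul_min sN _ mv) => b c mb Cc /=; have [r _ rE] := ha b mb.
    exists (r *: c); first exact: submodZ.
    rewrite scalerA [RHS]scalerA mulrC; congr (_ *: c); exact: rE.
  split=> // b mb; rewrite -coperp_self => c Cc.
  have := ha (b *: c) (smul_in mb Cc).
  by rewrite scalerA mulrC.
rewrite -coperp_self; exact: lenP.
Qed.

End Element.
End TypeOneIdeal.

End Duality.

(** * Uniqueness of the canonical ideal *)

Section Uniqueness.
Variables (R : comNzRingType) (m : set R).
Hypotheses (R_noeth : noetherian R) (R_local : local_ring m).
Hypothesis R_dim1 : krull_dim R^o = 1%N.

Let sm := submod_m R_local.

(** [(C : C') C' = C], where [C : C'] is multiplied by [c'] to become an ideal. Both sides have the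
    same orthogonal: if [a (C : C') C'] lies in [C], then [a C'] lies in [C : (C : C') = C'], so
    that [a] is in [C' : C' = R]. *)
Lemma conductor_mul (C C' : set R^o) (c' : R) : type_one_ideal m C -> type_one_ideal m C' ->
  C' c' -> m c' -> regular_on R^o c' ->
  smul (coperp C c' C') C' = homothety c' C.
Proof using R_noeth R_local R_dim1.
move=> C1 C1' C'c' mc' rc'; have [sC [c [Cc mc rc]] _] := C1; have [sC' _ _] := C1'.
set D := coperp C c' C'.
have scC := submod_homothety c' sC.
have sN := submod_smul D C'.
have NcC : smul D C' `<=` homothety c' C by apply: smul_min => // a v; exact.
(* orthogonals are taken with respect to [c' * c'], as [c'^2 C] lies in the product *)
have my : m (c' * c') by exact: (submodZ c' sm).
have ry := regular_mul rc' rc'.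
have CD v : C v -> D (c' * v).
  move=> Cv u C'u; exists (u * v); first exact: (submodZ u sC).
  by rewrite /GRing.scale /=; ring.
apply: (coperp_inj R_noeth R_local R_dim1 C1 my ry sN scC _ NcC (homothety_sub sC)).
  move=> _ [v Cv ->]; have := @smul_in R R^o D C' _ _ (CD v Cv) C'c'; congr (smul _ _ _).
  by rewrite /GRing.scale /=; ring.
move=> a ha.
have key v' : C' v' -> homothety c' C' (a *: v').
  move=> C'v'; pose w : R := a * v'.
  have Dw (e : R) : D e -> homothety (c' * c') C (e *: (w : R^o)).
    move=> De; have := ha _ (@smul_in R R^o D C' _ _ De C'v'); congr (homothety _ _ _).
    by rewrite /w /GRing.scale /=; ring.
  have : coperp C c' C w.
    move=> v Cv; have [s Cs sE] := Dw _ (CD v Cv); exists s => //.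
    apply: (regular_inj rc'); rewrite [RHS]scalerA -sE.
    by rewrite /GRing.scale /=; ring.
  rewrite (coperp_self R_noeth R_local R_dim1 C1 mc' rc') => -[w1 _ wE].
  have Dw1 (e : R) : D e -> homothety c' C (e *: w1).
    move=> /Dw[s Cs sE]; exists s => //; apply: (regular_inj rc').
    by rewrite [RHS]scalerA -sE wE !scalerA mulrC.
  exists w1; last exact: wE.
  have sK := submod_homothety c sC'; have sK1 := submod_adjoin (c *: w1) sK.
  have rcc := regular_mul rc rc'.
  have mcc : m (c * c') by exact: (submodZ c sm).
  (* multiplication by [c] moves [C'] and [w1] into [C], where the orthogonals with respect to
     [c c'] separate submodules *)
  suff : homothety c C' (c *: w1) by move=> [u C'u /(regular_inj rc) ->].
  rewrite (coperp_inj R_noeth R_local R_dim1 C1 mcc rcc sK sK1 _ (@sub_adjoin _ _ _ _)).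
  - exact: adjoin_self.
  - move=> _ [v Cv ->]; exists (v * c'); first exact: (submodZ v sC').
    by rewrite /GRing.scale /=; ring.
  - apply: adjoin_min => //.
      move=> _ [v _ ->]; rewrite /GRing.scale /= mulrC; exact: (submodZ v sC).
    by rewrite /GRing.scale /= mulrC; exact: (submodZ w1 sC).
  - move=> b hb.
    have Db : D b.
      move=> u C'u; have [s Cs sE] := hb (c *: u) (ex_intro2 _ _ u C'u erefl).
      exists s => //; apply: (regular_inj rc); by rewrite [RHS]scalerA -sE [LHS]scalerA [RHS]scalerA mulrC.
    move=> _ [k [_ [Kk [r ->] ->]]]; rewrite scalerDr.
    apply: submodD; [exact: submod_homothety|exact: hb|].
    have -> : b *: (r *: (c *: w1)) = r *: (b *: (c *: w1)).
      by rewrite [LHS]scalerA [RHS]scalerA mulrC.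
    apply: submodZ; first exact: submod_homothety.
    have [s Cs sE] := Dw1 _ Db; exists s => //.
    by transitivity (c *: (b *: w1)); [rewrite [LHS]scalerA [RHS]scalerA mulrC|rewrite sE scalerA].
have : coperp C' c' C' a by [].
rewrite (coperp_self R_noeth R_local R_dim1 C1' mc' rc') => -[r _ aE] _ [v Cv ->].
exists (r *: v); first exact: submodZ.
by have -> : a = c' * r := aE; rewrite /GRing.scale /=; ring.
Qed.

(** With [D = C : C'] and [D' = C' : C], [conductor_mul] gives [D C' = C] and [D' C = C'], hence
    [D D' C = C]. By Nakayama's lemma some product [d d'] is a unit, and [d] then maps [C'] onto
    [C]. The factors [c] and [c'] in the proof clear the denominators. *)
Lemma type_one_ideal_unique (C C' : set R^o) : type_one_ideal m C -> type_one_ideal m C' ->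
  exists c d : R, [/\ regular_on R^o c, regular_on R^o d & homothety d C' = homothety c C].
Proof using R_noeth R_local R_dim1.
move=> C1 C1'; have [sC [c [Cc mc rc]] _] := C1; have [sC' [c' [C'c' mc' rc']] _] := C1'.
have eD := conductor_mul C1 C1' C'c' mc' rc'.
have eD' := conductor_mul C1' C1 Cc mc rc.
set D := coperp C c' C' in eD; set D' := coperp C' c C in eD'.
have rcc := regular_mul rc rc'.
have mcc : m (c * c') by exact: (submodZ c sm).
have prod d d' : D d -> D' d' -> exists r, d * d' = c * c' * r.
  move=> Dd D'd'; suff : coperp C (c * c') C (d * d').
    by rewrite (coperp_self R_noeth R_local R_dim1 C1 mcc rcc) => -[r _ ->]; exists r.
  move=> v Cv; have [t C't tE] := D'd' v Cv; have [s Cs sE] := Dd t C't.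
  exists s => //; rewrite -[LHS]scalerA tE.
  by transitivity (c *: (d *: t)); [rewrite [LHS]scalerA [RHS]scalerA mulrC|rewrite sE scalerA].
have [d [d' [r [Dd D'd' mr ddr]]]] : exists d d' r, [/\ D d, D' d', ~ m r & d * d' = c * c' * r].
  apply: contrapT => nex.
  have CmC : C `<=` smul m C.
    move=> v Cv; have : homothety c (homothety c' C) (c *: (c' *: v)).
      by exists (c' *: v) => //; exists v.
    rewrite -eD => -[u Du uE].
    have sH := submod_homothety (c * c') (submod_smul m C).
    suff : homothety (c * c') (smul m C) (c *: u).
      by rewrite -uE scalerA => -[w mw /(regular_inj rcc) ->].
    have sP : submodule [set u : R^o | homothety (c * c') (smul m C) (c *: u)].
      exact: (submod_preimage (scale_linear c) sH).
    apply: (smul_min sP _ Du) => e t De C't /=.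
    have : homothety c C' (c *: t) by exists t.
    rewrite -eD' => ct.
    have -> : c *: (e *: t) = e *: (c *: t) by rewrite [LHS]scalerA [RHS]scalerA mulrC.
    have sP' : submodule [set u : R^o | homothety (c * c') (smul m C) (e *: u)].
      exact: (submod_preimage (scale_linear e) sH).
    apply: (smul_min sP' _ ct) => e' w D'e' Cw /=.
    have [q qE] := prod _ _ De D'e'; exists (q *: w); last by rewrite [LHS]scalerA qE [RHS]scalerA.
    apply: smul_in => //; apply: contrapT => mq; apply: nex.
    by exists e, e', q.
  have : [set (0 : R^o)] c.
    apply: (nakayama R_noeth R_local (submod_zero _) (R_noeth sC) _ Cc).
    by apply: subset_trans CmC _; exact: sums_right (submod_zero _).
  move=> /= c0; have := rc (1 : R^o); rewrite c0 scale0r => /(_ erefl) /eqP.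
  by rewrite oner_eq0.
have [s sr] := inverse_notin_m R_noeth R_local mr.
have eqH : homothety d C' = homothety c' C.
  apply/seteqP; split=> [_ [v C'v ->]|_ [v Cv ->]]; first exact: Dd.
  have [t C't tE] := D'd' v Cv; exists (s *: t); first exact: submodZ.
  apply: (regular_inj rc).
  have -> : c *: (d *: (s *: t)) = (s * d) *: (c *: t) by rewrite !scalerA; congr (_ *: _); ring.
  rewrite -tE !scalerA -[s * d * d']mulrA ddr.
  by rewrite -[in LHS](mul1r c) -sr; congr (_ *: v); ring.
exists c', d; split=> // a da.
have : homothety c' C (c' *: (c : R^o)) by exists c.
rewrite -eqH => -[t C't tE].
have dt : c' * c = d * t := tE; have da0 : d * (a : R) = 0 := da.
apply: (regular_mul rc' rc); rewrite dt.
by have : d * t * (a : R) = 0 by rewrite mulrAC da0 mul0r.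
Qed.

End Uniqueness.

(** * The residue field *)

Section ResidueField.
Variables (R : comNzRingType) (m : set R).

(** The hypotheses on the ring are parameters so that the quotient by [m] can be declared a
    field. *)
Definition ideal_pred & noetherian R & local_ring m : {pred R} := [in m].

Variables (R_noeth : noetherian R) (R_local : local_ring m).

Let ideal_pred_closed : idealr_closed (ideal_pred R_noeth R_local).
Proof.
have sm := submod_m R_local; split.
- by apply/mem_set; exact: (submod0 sm).
- by apply/negP => /set_mem; exact: notin_m1.
- move=> a u v /set_mem mu /set_mem mv; apply/mem_set.
  by apply: (submodD sm) => //; exact: (submodZ a sm).
Qed.

HB.instance Definition _ := isIdealr.Build R (ideal_pred R_noeth R_local) ideal_pred_closed.

Definition residue_field : Type := {ideal_quot (ideal_pred R_noeth R_local)}.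

HB.instance Definition _ := GRing.ComNzRing.on residue_field.

Definition residue (a : R) : residue_field := (\pi_({ideal_quot (ideal_pred R_noeth R_local)}) a)%qT.

HB.instance Definition _ := GRing.isZmodMorphism.Build R residue_field residue
  (fun a b => rmorphB _ a b).
HB.instance Definition _ := GRing.isMonoidMorphism.Build R residue_field residue
  (rmorph1 _, fun a b => rmorphM _ a b).

Lemma residue_onto (k : residue_field) : exists a, residue a = k.
Proof. by exists (repr k : R); exact: reprK. Qed.

Lemma residue_eq0 (a : R) : residue a = 0 <-> m a.
Proof.
have -> : (residue a = 0) = (residue a = residue 0) by rewrite rmorph0.
split=> [/eqmodP|ma]; first by rewrite /= Quotient.equivE subr0 => /set_mem.
by apply/eqmodP; rewrite /= Quotient.equivE subr0; exact/mem_set.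
Qed.

Let inv (k : residue_field) : residue_field := xget 0 [set l | l * k = 1].

Let mulVk (k : residue_field) : k != 0 -> inv k * k = 1.
Proof.
have [a <-] := residue_onto k => /eqP/residue_eq0 /(inverse_notin_m R_noeth R_local)[b ba].
rewrite /inv; case: xgetP => // /(_ (residue b)); case.
by rewrite /= -rmorphM ba rmorph1.
Qed.

Let inv0 : inv 0 = 0.
Proof. by apply: xgetPN => l /=; rewrite mulr0 => /esym/eqP; rewrite oner_eq0. Qed.

HB.instance Definition _ := GRing.ComNzRing_isField.Build residue_field mulVk inv0.

Lemma nonroot (p : {poly residue_field}) : infinite_residue_field m -> p != 0 ->
  exists a : R, p.[residue a] != 0.
Proof.
move=> R_inf p0; apply: contrapT => nex.
have rp k : root p k.
  have [a <-] := residue_onto k; apply: contrapT => /negP ra; apply: nex.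
  by exists a.
have [B _ sB] : exists2 B : {fset residue_field}, [set` B] `<=` setT & (#|` B| >= size p)%N.
  apply: infinite_set_fset => fin; apply: R_inf.
  apply: (@sub_finite_set _ _ ((fun k => [set b : R | residue b = k]) @` setT)).
    move=> _ [a _ <-]; exists (residue a) => //; apply/seteqP; split=> b /=.
      by move=> e; apply/residue_eq0; rewrite rmorphB /= e subrr.
    by move/residue_eq0; rewrite rmorphB /= => /eqP; rewrite subr_eq0 => /eqP.
  exact: finite_image.
have /(_ _ _)  := max_poly_roots p0 (rs := B).
move=> /(_ _ (fset_uniq B)); rewrite ltnNge sB => /(_ _) h.
by suff : false by []; apply: h; apply/allP => k _; exact: rp.
Qed.

End ResidueField.

(** * Minimal reductions *)

Section Pencils.
Variables (R : comNzRingType) (m : set R).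
Variables (R_noeth : noetherian R) (R_local : local_ring m).
Local Notation k := (residue_field R_noeth R_local).
Local Notation pi := (residue R_noeth R_local).

(** The determinant of a pencil is not the zero polynomial if one of its ends is the identity: it
    has the value 1 at 0, or it is a characteristic polynomial. *)
Lemma pencil_det n (T0 T1 : 'M[R]_n) : T0 = 1%:M \/ T1 = 1%:M ->
  exists2 p : {poly k}, p != 0 & forall t, p.[pi t] = pi (\det (T0 + t *: T1)).
Proof.
move=> T01; pose A0 := map_mx pi T0; pose A1 := map_mx pi T1.
pose p : {poly k} := \det (map_mx polyC A0 + 'X *: map_mx polyC A1).
have pE x : p.[x] = \det (A0 + x *: A1).
  rewrite -[p.[x]]/(horner_eval x p) -det_map_mx; congr (\det _).
  by apply/matrixP => i j; rewrite !mxE /= /horner_eval !hornerE.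
exists p; last first.
  move=> t; rewrite pE -det_map_mx; congr (\det _).
  by apply/matrixP => i j; rewrite !mxE rmorphD rmorphM.
case: T01 => TE.
  apply/negP => /eqP p0; have := pE 0; rewrite p0 horner0 scale0r addr0 /A0 TE map_mx1 det1.
  by move/esym/eqP; rewrite oner_eq0.
have -> : p = char_poly (- A0).
  rewrite /p /char_poly /char_poly_mx; congr (\det _).
  apply/matrixP => i j; rewrite /A1 TE map_mx1 !mxE polyCN opprK addrC; congr (_ + _).
  by case: eqP => _; rewrite ?mulr1 ?mulr0 ?polyC1 ?polyC0.
exact/monic_neq0/char_poly_monic.
Qed.

Section Modules.
Variable M : lmodType R.
Implicit Types (U V A D : set M).

(** Cramer's rule. *)
Lemma det_mem D n (T : 'M[R]_n) (b : 'I_n -> M) : submodule D -> pi (\det T) != 0 ->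
  (forall i, D (\sum_j T i j *: b j)) -> forall j, D (b j).
Proof.
move=> sD /eqP dT hD l.
have [s sE] : exists s, s * \det T = 1.
  by apply: (inverse_notin_m R_noeth R_local) => mT; apply/dT/residue_eq0.
rewrite -[b l]scale1r -sE -scalerA; apply: submodZ => //.
have -> : \det T *: b l = \sum_i (\adj T) l i *: \sum_j T i j *: b j.
  transitivity (\sum_j (\adj T *m T) l j *: b j).
    rewrite mul_adj_mx (bigD1 l) //= !mxE eqxx mulr1n big1 ?addr0 // => j jl.
    by rewrite !mxE eq_sym (negPf jl) mulr0n scale0r.
  under [RHS]eq_bigr => i _ do rewrite scaler_sumr.
  rewrite exchange_big /=; apply: eq_bigr => j _; rewrite mxE scaler_suml.
  by apply: eq_bigr => i _; rewrite scalerA.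
by apply: submod_sum => // i; exact: submodZ.
Qed.

Lemma gens_coef (s : seq M) v : gens s v ->
  exists c : 'I_(size s) -> R, v = \sum_i c i *: s`_i.
Proof.
elim: s v => [|u s IH] v; first by move=> ->; exists (fun=> 0); rewrite big_ord0.
move=> [w [_ [/IH[c ->] [r ->] ->]]].
exists (fun i => oapp c r (unlift ord0 i)); rewrite big_ord_recl unlift_none addrC.
by congr (_ + _); apply: eq_bigr => i _; rewrite liftK.
Qed.

Definition covers U V A (z : R) : Prop := V `<=` sums (homothety z U) A.

(** On the line [z0 + t z1] through a covering [z0] or [z1], covering fails only at roots
    of a determinant: express [z0 U] and [z1 U] in generators of [V]. *)
Lemma covers_pencil U V A (z0 z1 : R) : submodule U -> submodule V -> submodule A ->
  finitely_generated V -> homothety z0 U `<=` V -> homothety z1 U `<=` V ->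
  covers U V A z0 \/ covers U V A z1 ->
  exists2 p : {poly k}, p != 0 & forall t, p.[pi t] != 0 -> covers U V A (z0 + t * z1).
Proof.
move=> sU sV sA [n /generated_byP[s _ VE]] z0U z1U cov.
have sbV (i : 'I_(size s)) : V s`_i by rewrite VE; apply: gens_in; exact: mem_nth.
have coef z : homothety z U `<=` V -> forall u, U u ->
    exists c : 'I_(size s) -> R, z *: u = \sum_i c i *: s`_i.
  by move=> zU u Uu; apply: gens_coef; rewrite -VE; apply: zU; exists u.
suff [u [T0 [T1 [Uu T01 TE]]]] : exists (u : 'I_(size s) -> M) (T0 T1 : 'M[R]_(size s)),
   [/\ forall i, U (u i), T0 = 1%:M \/ T1 = 1%:M & forall i t,
     A ((z0 + t * z1) *: u i - \sum_j (T0 + t *: T1) i j *: s`_j)].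
  have [p p0 pE] := pencil_det T01; exists p => // t; rewrite pE => dT.
  set D := sums (homothety (z0 + t * z1) U) A.
  have sD : submodule D by apply: submod_sums => //; exact: submod_homothety.
  have Ds : forall j : 'I_(size s), D s`_j.
    apply: (det_mem sD dT) => i.
    rewrite -[\sum_j _](subKr ((z0 + t * z1) *: u i)); apply: submodB => //.
      by apply: sums_left => //; exists (u i).
    by apply: sums_right => //; exact: submod_homothety.
  rewrite /covers VE; apply: gens_min => // v /(nthP 0)[i ilt <-].
  exact: (Ds (Ordinal ilt)).
have one_sum (i : 'I_(size s)) : \sum_j (1%:M : 'M[R]__) i j *: s`_j = s`_i.
  rewrite (bigD1 i) //= mxE eqxx scale1r big1 ?addr0 // => j ji.
  by rewrite mxE eq_sym (negPf ji) scale0r.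
have split_sum (B C : 'M[R]_(size s)) i t :
    \sum_j (B + t *: C) i j *: s`_j = \sum_j B i j *: s`_j + t *: \sum_j C i j *: s`_j.
  rewrite scaler_sumr -big_split /=; apply: eq_bigr => j _.
  by rewrite !mxE scalerDl scalerA.
have pick z : covers U V A z -> exists u : 'I_(size s) -> M,
    forall i, U (u i) /\ A (z *: u i - s`_i).
  move=> cz; have h (i : 'I_(size s)) : exists u, U u /\ A (z *: u - s`_i).
    have [_ [a [[u Uu ->] Aa e]]] := cz _ (sbV i); exists u; split=> //.
    by rewrite e opprD addrA subrr add0r; exact: submodN.
  by have [u uP] := choice h; exists u.
have mat z (u : 'I_(size s) -> M) : homothety z U `<=` V -> (forall i, U (u i)) ->
    exists C : 'M[R]_(size s), forall i, z *: u i = \sum_j C i j *: s`_j.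
  move=> zU Uu; have [c cE] := choice (fun i => coef z zU (u i) (Uu i)).
  by exists (\matrix_(i, j) c i j) => i; rewrite cE; apply: eq_bigr => j _; rewrite mxE.
case: cov => /pick[u uP].
  have [C CE] := mat z1 u z1U (fun i => (uP i).1).
  exists u, 1%:M, C; split; [by move=> i; case: (uP i)|by left|move=> i t].
  rewrite split_sum one_sum -CE scalerDl scalerA opprD addrACA subrr addr0.
  by case: (uP i).
have [C CE] := mat z0 u z0U (fun i => (uP i).1).
exists u, C, 1%:M; split; [by move=> i; case: (uP i)|by right|move=> i t].
rewrite split_sum one_sum -CE scalerDl -scalerA opprD addrACA subrr add0r -scalerBr.
by apply: submodZ => //; case: (uP i).
Qed.

(** The determinants that belong to the finitely many conditions have a common nonroot because the
    residue field is infinite. *)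
Lemma covers_common (T : eqType) (s : seq T) (U V : T -> set M) A (I : set R^o) :
  infinite_residue_field m -> submodule I -> submodule A ->
  (forall i, i \in s -> [/\ submodule (U i), submodule (V i), finitely_generated (V i) &
     forall z, I z -> homothety z (U i) `<=` V i]) ->
  (forall i, i \in s -> exists2 z, I z & covers (U i) (V i) A z) ->
  exists2 z, I z & forall i, i \in s -> covers (U i) (V i) A z.
Proof.
move=> R_inf sI sA; elim: s => [|i s IH] sUV cov; first by exists 0 => //; exact: (submod0 sI).
have sUV' l : l \in s -> _ := fun ls => sUV l (mem_behead (s := i :: s) ls).
have [z0 I0 z0P] := IH sUV' (fun l ls => cov l (mem_behead (s := i :: s) ls)).
have [z1 I1 z1P] := cov i (mem_head _ _).
suff [p p0 pP] : exists2 p : {poly k}, p != 0 & forall t, p.[pi t] != 0 ->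
    forall l, l \in i :: s -> covers (U l) (V l) A (z0 + t * z1).
  have [t /pP tP] := nonroot R_inf p0; exists (z0 + t * z1) => //.
  by apply: (submodD sI) => //; exact: (submodZ t sI).
have cov' l : l \in i :: s -> covers (U l) (V l) A z0 \/ covers (U l) (V l) A z1.
  by rewrite inE => /orP[/eqP->|/z0P]; [right|left].
elim: (i :: s) sUV cov' => [|l r IHr] sr cr; first by exists 1; rewrite ?oner_eq0.
have [p p0 pP] := IHr (fun j js => sr j (mem_behead (s := l :: r) js))
  (fun j js => cr j (mem_behead (s := l :: r) js)).
have [sUl sVl fgl IV] := sr l (mem_head _ _).
have [q q0 qP] := covers_pencil sUl sVl sA fgl (IV _ I0) (IV _ I1) (cr l (mem_head _ _)).
exists (p * q); first by rewrite mulf_neq0.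
move=> t; rewrite hornerM mulf_eq0 negb_or => /andP[pt qt] j.
by rewrite inE => /orP[/eqP->|jr]; [exact: qP|exact: pP].
Qed.

End Modules.
End Pencils.

Section Reductions.
Variables (R : comNzRingType) (m : set R).
Hypotheses (R_noeth : noetherian R) (R_local : local_ring m).
Hypothesis R_inf : infinite_residue_field m.
Variables (I : set R^o) (sI : submodule I).

Local Notation P k := (@power_mul R R^o I k).

Let sP k : submodule (P k) := submod_power R^o I k.

Lemma power_in k (a : R) (w : R^o) : I a -> P k w -> P k.+1 (a *: w).
Proof. exact: smul_in. Qed.

(** [u I^(k+1)] is the sum of the [u l I^k] over the generators [l] of [I]. *)
Lemma homothety_powerS (s : seq R^o) (D : set R^o) (u : R) k : I = gens s -> submodule D ->
  (forall l : R, l \in s -> homothety (u * l) (P k) `<=` D) -> homothety u (P k.+1) `<=` D.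
Proof.
move=> IE sD h _ [v Pv ->].
apply: (smul_min (submod_preimage (scale_linear (M := R^o) u) sD) _ Pv) => a w Ia Pw /=.
have sN : submodule [set b : R^o | D (u *: (b * w : R^o))].
  apply: (@submod_preimage _ R^o R^o (fun b : R^o => u *: (b * w : R^o))) => // b x y.
  by rewrite /GRing.scale /=; ring.
have IN : I `<=` [set b : R^o | D (u *: (b * w : R^o))].
  rewrite IE; apply: gens_min => // l ls /=; apply: (h l ls).
  by exists w => //; rewrite -scalerA.
exact: (IN _ Ia).
Qed.

(** Eakin-Sathaye for one generator, by induction on [k]. If no generator [l] of [I] satisfies
    [u I^(k+1) = l u I^k] modulo [A], each [u l I^k] has smaller length, and an element [z] that
    works for all the [u l] at level [k] works for [u]. *)
Lemma covering_element (A B : set R^o) k (u : R) : submodule A -> submodule B ->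
  A `<=` B -> finite_length A B -> homothety u (P k.+1) `<=` B ->
  (len A (sums (homothety u (P k.+1)) A) <= k.+1)%N ->
  exists2 z, I z & covers (homothety u (P k)) (homothety u (P k.+1)) A z.
Proof using R_noeth R_local R_inf sI.
move=> sA sB AB fl; have [n /generated_byP[s _ IE]] := R_noeth sI.
have Il l : l \in s -> I l by rewrite IE; exact: gens_in.
have sH v j := submod_homothety v (sP j).
have sHA v j : submodule (sums (homothety v (P j)) A) by exact: submod_sums.
have sub j v l : l \in s -> homothety (v * l) (P j) `<=` homothety v (P j.+1).
  move=> /Il Ia _ [w Pw ->]; exists (l *: w); first exact: power_in.
  by rewrite scalerA.
have small j v l : l \in s -> homothety v (P j.+1) `<=` B ->
    ~ covers (homothety v (P j)) (homothety v (P j.+1)) A l ->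
    finite_length A (sums (homothety (v * l) (P j)) A) /\
    (len A (sums (homothety (v * l) (P j)) A) < len A (sums (homothety v (P j.+1)) A))%N.
  move=> ls vB ncov; set Sl := sums _ _; set S := sums _ A.
  have sSl : submodule Sl by exact: sHA.
  have sS : submodule S by exact: sHA.
  have ASl : A `<=` Sl by exact: sums_right.
  have SlS : Sl `<=` S.
    apply: sums_min => //; last exact: sums_right.
    by apply: subset_trans (sub j v l ls) _; exact: sums_left.
  have SB : S `<=` B by exact: sums_min.
  have fS := finite_length_sub sA (@subset_refl _ _) (subset_trans ASl SlS) SB fl.
  split; first exact: (finite_length_sub sA (@subset_refl _ _) ASl (subset_trans SlS SB) fl).
  rewrite (lenD sA sSl sS ASl SlS fS) -addn1 leq_add2l lt0n; apply/eqP => l0; apply: ncov.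
  have SE := len_eq0 sSl sS SlS (finite_length_sub sSl ASl SlS (@subset_refl _ _) fS) l0.
  have VS : homothety v (P j.+1) `<=` S by exact: sums_left.
  by apply: subset_trans VS _; rewrite -SE /Sl homothetyA mulrC.
elim: k u => [|k IH] u uB le.
  have [[l [ls cl]]|nex] :=
    pselect (exists l, l \in s /\ covers (homothety u (P 0)) (homothety u (P 1)) A l).
    by exists l => //; exact: Il.
  exists 0; first exact: (submod0 sI).
  apply: (homothety_powerS IE); first by apply: submod_sums => //; exact: submod_homothety.
  move=> l ls; have [|fSl lSl] := small 0%N u l ls uB; first by move=> h; apply: nex; exists l.
  have ASl : A `<=` sums (homothety (u * l) (P 0)) A by exact: sums_right.
  have l0 : len A (sums (homothety (u * l) (P 0)) A) = 0%N.
    by apply/eqP; rewrite -leqn0 -ltnS; exact: leq_trans lSl le.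
  have AE := len_eq0 sA (sHA _ _) ASl fSl l0.
  have lA : homothety (u * l) (P 0) `<=` A by rewrite [X in _ `<=` X]AE; exact: sums_left.
  by apply: subset_trans lA _; apply: sums_right; exact: submod_homothety.
have [[l [ls cl]]|nex] :=
    pselect (exists l, l \in s /\ covers (homothety u (P k.+1)) (homothety u (P k.+2)) A l).
  by exists l => //; exact: Il.
have cov l : l \in s ->
    exists2 z, I z & covers (homothety (u * l) (P k)) (homothety (u * l) (P k.+1)) A z.
  move=> ls; apply: IH; first exact: subset_trans (sub _ _ _ ls) uB.
  have [|fSl lSl] := small k.+1 u l ls uB; first by move=> h; apply: nex; exists l.
  by rewrite -ltnS; exact: leq_trans lSl le.
have UV l : l \in s -> [/\ submodule (homothety (u * l) (P k)),
     submodule (homothety (u * l) (P k.+1)), finitely_generated (homothety (u * l) (P k.+1)) &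
     forall z, I z -> homothety z (homothety (u * l) (P k)) `<=` homothety (u * l) (P k.+1)].
  move=> ls; split=> //; first by apply: R_noeth; exact: sH.
  move=> z Iz _ [_ [w Pw ->] ->]; exists (z *: w); first exact: power_in.
  by rewrite [LHS]scalerA [RHS]scalerA mulrC.
have [z Iz zP] := covers_common R_noeth R_local R_inf sI sA UV cov.
exists z => //; rewrite /covers; set D := sums _ A.
have sD : submodule D by apply: submod_sums => //; exact: submod_homothety.
apply: (homothety_powerS IE sD) => l ls; apply: subset_trans (zP l ls) _.
apply: sums_min => //; last by apply: sums_right; exact: submod_homothety.
apply: subset_trans (sums_left sA); apply: homothetyS; exact: sub.
Qed.

Hypothesis R_dim1 : krull_dim R^o = 1%N.

(** [I^n / m I^n] has at most the length [L] of [I^n / y I^n], which is that of [R / yR] for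
    all [n]. So [covering_element] applies to [n = L] and [u = 1], and Nakayama's lemma removes the
    term [m I^n]. *)
Lemma reduction (c : R) : I c -> regular_on R^o c -> (exists2 y, m y & regular_on R^o y) ->
  exists z n0, [/\ I z, regular_on R^o z &
    forall n, (n0 <= n)%N -> P n.+1 = homothety z (P n)].
Proof using R_noeth R_local R_inf R_dim1 sI.
move=> Ic rc [y my ry].
have cP n : P n (c ^+ n).
  elim: n => // n IH; rewrite exprS; exact: (power_in Ic IH).
have fP n : finite_length (P n) [set: R^o].
  by apply: (finite_colength R_noeth R_local R_dim1 (regular_exp (n := n) rc)).
pose L := len (homothety y [set: R^o]) [set: R^o].
have fL := finite_homothety R_noeth R_local R_dim1 ry.
have syR := submod_homothety y (submodT R^o).
have Lpos : (0 < L)%N.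
  rewrite lt0n; apply/eqP => L0; apply: (notin_m1 R_local).
  have : [set: R^o] 1 by [].
  rewrite -(len_eq0 syR (submodT _) (@subsetT _ _) fL L0) => -[r _ ->].
  by rewrite /GRing.scale /= mulrC; exact: (submodZ r (submod_m R_local)).
case LE : L Lpos => [//|k] _.
pose B := P k.+1; pose A := smul m B.
have sA : submodule A by exact: submod_smul.
have AB : A `<=` B by exact: smul_sub (sP _).
have [fyB lyB] := len_mod_regular R_noeth R_local R_dim1 ry (sP k.+1) (fP k.+1).
have syB := submod_homothety y (sP k.+1).
have yBA : homothety y B `<=` A by move=> _ [v Bv ->]; exact: smul_in.
have fyBB := finite_length_sub syB (@subset_refl _ _) (homothety_sub (sP _)) (@subsetT _ _) fyB.
have fAB := finite_length_sub sA yBA AB (@subset_refl _ _) fyBB.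
have BE : sums (homothety 1 B) A = B.
  rewrite homothety1; apply/seteqP; split; first exact: (sums_min (sP _) (@subset_refl _ _) AB).
  exact: sums_left.
have [||z Iz cov] := covering_element (u := 1) (k := k) sA (sP k.+1) AB fAB.
- by rewrite homothety1.
- rewrite BE -LE /L -lyB (lenD syB sA (sP _) yBA AB fyBB); exact: leq_addl.
move: cov; rewrite /covers !homothety1 => cov.
have Bz : B `<=` homothety z (P k).
  by apply: (nakayama R_noeth R_local _ (R_noeth (sP k.+1)) cov); exact: submod_homothety.
have PE n : P (k + n).+1 = homothety z (P (k + n)).
  elim: n => [|n IH]; apply/seteqP; split; rewrite ?addn0.
  - exact: Bz.
  - by move=> _ [w Pw ->]; exact: power_in.
  - rewrite addnS; apply: smul_min; first exact: submod_homothety.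
    move=> a v Ia Pv; have [w Pw ->] : homothety z (P (k + n)) v by rewrite -IH.
    exists (a *: w); first exact: power_in.
    by rewrite [LHS]scalerA [RHS]scalerA mulrC.
  - by move=> _ [w Pw ->]; exact: power_in.
exists z, k; split=> // [v zv|n /subnKC <-]; last exact: PE.
have := cP k.+1 => /Bz[w _ cE].
apply: (regular_exp (n := k.+1) rc).
have {}cE : c ^+ k.+1 = z * w := cE; have {}zv : z * (v : R) = 0 := zv.
by rewrite cE; have : z * (w : R) * (v : R) = 0 by rewrite mulrAC zv mul0r.
Qed.

End Reductions.

(** * Multiplicities *)

(** The polynomial is unique because it is known at all large integers. *)
Lemma multiplicity_eq (R : comNzRingType) (I : set R) (M : lmodType R) (p : {poly rat}) n0 :
  (forall n, (n0 <= n)%N -> exists l,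
     length_is (@power_mul R M I n) [set: M] l /\ p.[n%:R] = l%:R) ->
  multiplicity I M = ((krull_dim M)`!)%:R * p`_(krull_dim M).
Proof.
move=> pP; apply: xget_unique; first by exists p; split=> //; exists n0.
move=> _ [q [[n1 qP] ->]]; suff -> : q = p by [].
apply/eqP; rewrite -subr_eq0; apply/negPn/negP => qp0.
pose rs := [seq (n%:R : rat) | n <- iota (maxn n0 n1) (size (q - p))].
have /(_ _ _) := max_poly_roots qp0 (rs := rs).
rewrite size_map size_iota ltnn => h; suff : false by []; apply: h.
  apply/allP => x /mapP[n]; rewrite mem_iota geq_max => /andP[/andP[n0n n1n] _] {x}->.
  have [l [lp pn]] := pP n n0n; have [k [lq qn]] := qP n n1n.
  by rewrite rootE !hornerE pn qn (length_is_unique lp lq) subrr.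
by rewrite map_inj_uniq ?iota_uniq // => i j /eqP; rewrite Num.Theory.eqr_nat => /eqP.
Qed.

Lemma nat_max0 (S : set nat) : (forall k, S k -> k = 0%N) -> nat_max S = 0%N.
Proof. by move=> S0; rewrite /nat_max; case: xgetP => // k _ [/S0]. Qed.

Lemma nat_min_le (S : set nat) k : S k -> (nat_min S <= k)%N.
Proof.
move=> Sk; have ex : exists n, `[< S n >] by exists k; apply/asboolP.
case: (ex_minnP ex) => l /asboolP Sl lmin.
have := xgetI 0%N (P := [set n | S n /\ forall k, S k -> (n <= k)%N]) (x := l).
case=> [|_ ->] //; split=> // j Sj; apply: lmin; exact/asboolP.
Qed.

Lemma nat_min_eq (S : set nat) l : S l -> (forall k, S k -> (l <= k)%N) -> nat_min S = l.
Proof.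
move=> Sl ml; apply: xget_unique => // k [Sk mk].
by apply/eqP; rewrite eqn_leq mk // ml.
Qed.

Section FiniteLengthModules.
Variables (R : comNzRingType) (m : set R).
Hypotheses (R_noeth : noetherian R) (R_local : local_ring m).
Variable X : lmodType R.

Let zX : set X := [set 0].

Hypothesis fX : finite_length zX [set: X].

Let sz : submodule zX := submod_zero X.
Let l := len zX [set: X].

Lemma m_power_zero n : (l <= n)%N -> @power_mul R X m n = zX.
Proof using R_noeth R_local fX.
move=> ln; apply/seteqP; split; last by move=> _ ->; exact: (submod0 (submod_power _ _ _)).
have l0 := power_kills_finite_length R_noeth R_local sz (submodT X) (@subsetT _ _) fX.
rewrite -(subnK ln) /power_mul iterD; elim: (n - l)%N => [|k IH] //=.
by apply: subset_trans (smulS IH) _; exact: smul_sub.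
Qed.

(** A power of [m] annihilates [X], so [m] is the only prime that can contain the
    annihilator. *)
Lemma krull_dim_finite_length : krull_dim X = 0%N.
Proof using R_noeth R_local fX.
apply: nat_max0 => -[//|k] [P [prP chP]].
have Pm i : (i <= k.+1)%N -> P i = m.
  move=> /prP[[sP P1 pP] annP]; apply/seteqP; split; first exact: (proper_sub_m R_noeth R_local).
  move=> a ma; have : P i (a ^+ l).
    apply: annP => v; have aP n : @power_mul R X m n (a ^+ n *: v).
      by elim: n => [|n IH] //; rewrite exprS -scalerA; exact: smul_in.
    by have := aP l; rewrite m_power_zero.
  by elim: l => [|n IH]; [rewrite expr0 => /P1|rewrite exprS => /pP[]].
by have [_ []] := chP 0%N isT; rewrite !Pm.
Qed.

Lemma multiplicity_finite_length : multiplicity m X = l%:R.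
Proof using R_noeth R_local fX.
rewrite (@multiplicity_eq _ _ _ (l%:R)%:P l) => [|n ln].
  by rewrite krull_dim_finite_length coefC mul1r.
by exists l; rewrite m_power_zero // hornerC; split=> //; exact: lenP.
Qed.

Lemma nu_semisimple : (forall (b : R) (v : X), m b -> b *: v = 0) -> nu X = l.
Proof using R_noeth R_local fX.
move=> mX; apply: nat_min_eq => [|k /generated_byP[s <- sE]].
  have [s sz' sE] := len_generators R_noeth R_local sz (submodT X) (@subsetT _ _) fX.
  by apply/generated_byP; exists s.
have [_] := @len_generators_le _ _ R_noeth R_local X zX s sz (fun u b _ => mX b u).
by rewrite /l sE.
Qed.

(** [X] is generated by as many elements as the length of [X / mX], so [mX] has length zero. *)
Lemma semisimple_of_nu : nu X = l -> forall (b : R) (v : X), m b -> b *: v = 0.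
Proof using R_noeth R_local fX.
move=> nuX; pose A := smul m [set: X]; have sA : submodule A by exact: submod_smul.
have zA : zX `<=` A by move=> _ ->; exact: submod0.
have fA := finite_length_sub sA zA (@subsetT _ A) (@subset_refl _ _) fX.
have [s sE XE] := len_generators R_noeth R_local sA (submodT X) (@subsetT _ _) fA.
have fg : finitely_generated [set: X].
  have [t tE YE] := len_generators R_noeth R_local sz (submodT X) (@subsetT _ _) fX.
  by exists (size t); apply/generated_byP; exists t.
have Xs : [set: X] `<=` gens s.
  apply: (nakayama R_noeth R_local (submod_gens s) fg).
  by rewrite -gens_over_sums // -XE.
have : (nu X <= len A [set: X])%N.
  by rewrite -sE; apply: nat_min_le; apply/generated_byP; exists s => //; apply/seteqP.
rewrite nuX /l (lenD sz sA (submodT X) zA (@subsetT _ _) fX) -{2}[len A _]add0n leq_add2r leqn0.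
move=> /eqP l0 b v mb.
have fzA := finite_length_sub sz (@subset_refl _ _) zA (@subsetT _ A) fX.
have : A (b *: v) by exact: smul_in.
by rewrite -(len_eq0 sz sA zA fzA l0).
Qed.

End FiniteLengthModules.

(** * Quotient modules *)

Section Quotients.
Variables (R : comNzRingType) (V X : lmodType R) (N : set V) (g : {linear V -> X}).
Hypotheses (sN : submodule N) (g_onto : range g = [set: X]).
Hypothesis g_ker : forall v, g v = 0 <-> N v.

Lemma length_quotient l : length_is N [set: V] l <-> length_is [set (0 : X)] [set: X] l.
Proof using All.
apply: (@length_is_transfer R V X g) => //.
- by move=> a u v; exact: linearP.
- exact: submodT.
- exact: submod_zero.
- exact: submodT.
- by move=> v _; exact: g_ker.
- move=> w _; have : [set: X] w by [].
  by rewrite -g_onto => -[v _ <-]; exists v => //; rewrite /= subrr.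
Qed.

End Quotients.

Section QuotientModule.
Variables (R : comNzRingType) (V : lmodType R) (N : set V) (sN : submodule N).

Definition quotient_module : Type := Quotient.quot (submod_pred sN).

HB.instance Definition _ := GRing.Zmodule.on quotient_module.

Local Notation Q := quotient_module.
Definition quotient_map (v : V) : Q := (\pi_(Quotient.quot (submod_pred sN)) v)%qT.

Lemma quotient_map_eq u v : quotient_map u = quotient_map v <-> N (u - v).
Proof.
split=> [/eqmodP|Nuv]; first by rewrite /= Quotient.equivE => /set_mem.
by apply/eqmodP; rewrite /= Quotient.equivE; exact/mem_set.
Qed.

Lemma quotient_mapK (x : Q) : quotient_map (repr x) = x.
Proof. exact: reprK. Qed.

Lemma quotient_mapD u v : quotient_map (u + v) = quotient_map u + quotient_map v.
Proof. exact: raddfD. Qed.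

(** Scaling is defined on representatives; [quotient_mapZ] is its independence of the choice. *)
Definition quotient_scale (a : R) (x : Q) : Q := quotient_map (a *: repr x).

Lemma quotient_mapZ a v : quotient_map (a *: v) = quotient_scale a (quotient_map v).
Proof.
apply/quotient_map_eq; rewrite -scalerBr; apply: submodZ => //.
by apply/quotient_map_eq; rewrite quotient_mapK.
Qed.

Let scaleA a b x : quotient_scale a (quotient_scale b x) = quotient_scale (a * b) x.
Proof. by rewrite {2}/quotient_scale -quotient_mapZ scalerA. Qed.

Let scale1 : left_id 1 quotient_scale.
Proof. by move=> x; rewrite /quotient_scale scale1r quotient_mapK. Qed.

Let scaleDr : right_distributive quotient_scale +%R.
Proof.
move=> a x y; rewrite -[x]quotient_mapK -[y]quotient_mapK -quotient_mapD -!quotient_mapZ.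
by rewrite scalerDr quotient_mapD.
Qed.

Let scaleDl x : {morph quotient_scale^~ x : a b / a + b}.
Proof. by move=> a b; rewrite /quotient_scale scalerDl quotient_mapD. Qed.

HB.instance Definition _ :=
  GRing.Zmodule_isLmodule.Build R Q scaleA scale1 scaleDr scaleDl.

Lemma quotient_map_linear : linear quotient_map.
Proof. by move=> a u v; rewrite quotient_mapD quotient_mapZ. Qed.

End QuotientModule.

(** * The canonical degree *)

Section CanonicalDegree.
Variables (R : comNzRingType) (m : set R).
Hypotheses (R_noeth : noetherian R) (R_local : local_ring m).
Hypothesis R_dim1 : krull_dim R^o = 1%N.
Variable C : set R^o.
Hypothesis C1 : type_one_ideal m C.

Let sm := submod_m R_local.
Let sC : submodule C. Proof. by case: C1. Qed.

Local Notation mI := (m : set R^o).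
Local Notation P k := (@power_mul R R^o C k).

Section Reduction.
Variables (z : R) (n0 : nat).
Hypotheses (Cz : C z) (rz : regular_on R^o z).
Hypothesis zP : forall n, (n0 <= n)%N -> P n.+1 = homothety z (P n).

Let zR := homothety z [set: R^o].
Let szR : submodule zR := submod_homothety z (submodT _).
Let fzR : finite_length zR [set: R^o] := finite_homothety R_noeth R_local R_dim1 rz.

Let zRC : zR `<=` C.
Proof. by move=> _ [r _ ->]; rewrite /GRing.scale /= mulrC; exact: (submodZ r sC). Qed.

Lemma multiplicity_reduction : @multiplicity R C R^o = (len zR [set: R^o])%:R.
Proof using All.
have fP n : finite_length (P n) [set: R^o].
  have zn : P n (z ^+ n) by elim: n => // n IH; rewrite exprS; exact: smul_in.
  exact: (finite_colength R_noeth R_local R_dim1 (regular_exp (n := n) rz) (submod_power _ _ _) zn).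
pose L := len zR [set: R^o]; pose l n := len (P n) [set: R^o].
have lS n : (n0 <= n)%N -> l n.+1 = (L + l n)%N.
  move=> /zP zPn; rewrite /l zPn.
  have sP := submod_power R^o C n; have szP := submod_homothety z sP.
  have PR : homothety z (P n) `<=` zR by exact: homothetyS.
  have fzP : finite_length (homothety z (P n)) [set: R^o] by rewrite -zPn.
  rewrite (lenD szP szR (submodT _) PR (@subsetT _ _) fzP).
  by rewrite (len_homothety rz sP (submodT _) (@subsetT _ _)).2 addnC.
have lE k : l (n0 + k)%N = (L * k + l n0)%N.
  by elim: k => [|k IH]; rewrite ?addn0 ?muln0 // addnS lS ?leq_addr // IH mulnS addnA.
pose p : {poly rat} := L%:R *: 'X + ((l n0)%:R - (L * n0)%:R)%:P.
rewrite (@multiplicity_eq R C R^o p n0) => [|n /subnKC <-].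
  by rewrite R_dim1 /p coefD coefZ coefX coefC mulr1 addr0 mul1r.
exists (l (n0 + (n - n0))%N); split; first exact: lenP.
by rewrite lE /p !hornerE /= !natrD !natrM; ring.
Qed.

Lemma cdeg_reduction : @cdeg R C = (len zR C)%:R.
Proof using All.
have fC : finite_length C [set: R^o].
  exact: (finite_colength R_noeth R_local R_dim1 rz).
rewrite /cdeg multiplicity_reduction (lenD szR sC (submodT _) zRC (@subsetT _ _) fzR).
have -> : @colength R C = len C [set: R^o] by [].
by rewrite natrD addrK.
Qed.

Lemma len_homothety_m : finite_length (homothety z mI) C /\
  len (homothety z mI) C = (len zR C).+1.
Proof using All.
have szm := submod_homothety z sm.
have mR : adjoin (m : set R^o) (1 : R^o) = [set: R^o].
  apply/seteqP; split=> // a _; exists 0, a; split; first exact: (submod0 sm).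
    by exists a; rewrite /GRing.scale /= mulr1.
  by rewrite add0r.
have m1b (b : R) : m b -> (m : set R^o) (b *: (1 : R^o)).
  by rewrite /GRing.scale /= mulr1.
have [fm lm] := len_adjoin1 R_noeth R_local sm m1b (notin_m1 R_local).
rewrite mR in fm lm.
have [h1 h2] := len_homothety rz sm (submodT _) (@subsetT _ _).
have mzR : homothety z mI `<=` zR by exact: homothetyS.
have fzC := finite_length_sub szR (@subset_refl _ _) zRC (@subsetT _ _) fzR.
have [f ->] := finite_length_add szm szR sC mzR zRC (iffRL h1 fm) fzC.
by rewrite h2 lm.
Qed.

(** Both sides compare lengths below [C]: [z m] has colength [cdeg + 1] in [C], and [m C]
    contains it and has colength the type. *)
Lemma cdeg_eq_type : @cdeg R C = (len (smul m C) C)%:R - 1 <-> smul m C = homothety z mI.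
Proof using All.
have szm := submod_homothety z sm; have smC := submod_smul m C.
have zmC : homothety z mI `<=` smul m C.
  by move=> _ [b mb ->]; rewrite /GRing.scale /= mulrC; exact: (smul_in (M := R^o) mb Cz).
have mCC := smul_sub (J := m) sC.
have [f l] := len_homothety_m.
have fzm := finite_length_sub szm (@subset_refl _ _) zmC mCC f.
have lE := lenD szm smC sC zmC mCC f; rewrite l in lE.
rewrite cdeg_reduction; split=> [/eqP|mCE].
  rewrite eq_sym subr_eq natr1 Num.Theory.eqr_nat lE => /eqP e.
  apply/esym/(len_eq0 szm smC zmC fzm); apply/eqP.
  by rewrite -(eqn_add2r (len (smul m C) C)) add0n -e.
by apply/eqP; rewrite eq_sym subr_eq natr1 Num.Theory.eqr_nat lE mCE (len_refl szm).2.
Qed.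

(** If [m C = c m] with [c] in [C], then [c ^+ n m = m C ^+ n] for all [n], and comparing two
    consecutive exponents shows that [c m = z m]. *)
Lemma smul_m_reduction (c : R) : C c -> regular_on R^o c -> smul m C = homothety c mI ->
  smul m C = homothety z mI.
Proof using All.
move=> Cc rc mCE.
have sH v (N : set R^o) : submodule N -> submodule (homothety v N) := @submod_homothety _ _ v N.
have mP k : smul m (P k) = homothety (c ^+ k) mI.
  elim: k => [|k IH].
    rewrite expr0 homothety1; apply/seteqP; split.
      by apply: smul_min => // a v ma _; rewrite /GRing.scale /= mulrC; exact: (submodZ v sm).
    move=> a ma; have := smul_in (M := R^o) ma (I : [set: R^o] 1).
    by rewrite /GRing.scale /= mulr1.
  apply/seteqP; split.
    apply: smul_min => [|b p mb]; first exact: sH.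
    have sN := submod_preimage (scale_linear (M := R^o) b) (sH (c ^+ k.+1) _ sm).
    apply: (smul_min sN) => a q Ca Pq /=.
    have : smul m (P k) (b *: q) by exact: smul_in.
    rewrite IH => -[b' mb' bq].
    have : smul m C (b' *: (a : R^o)) by exact: smul_in.
    rewrite mCE => -[b'' mb'' ba]; exists b'' => //.
    have {}bq : b * (q : R) = c ^+ k * b' := bq.
    have {}ba : (b' : R) * (a : R) = c * b'' := ba.
    have : b * ((a : R) * (q : R)) = c ^+ k.+1 * (b'' : R); last by [].
    by rewrite mulrCA bq mulrCA [(a : R) * b']mulrC ba exprSr mulrA.
  move=> _ [b mb ->].
  have sN := submod_preimage (scale_linear (M := R^o) c) (submod_smul m (P k.+1)).
  have : smul m (P k) (c ^+ k *: (b : R^o)) by rewrite IH; exists b.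
  suff sub : smul m (P k) `<=` [set u : R^o | smul m (P k.+1) (c *: u)].
    by move=> /sub /=; rewrite scalerA exprS.
  apply: (smul_min sN) => b' p mb' Pp /=.
  have -> : c *: (b' *: p) = b' *: (c *: p) by rewrite [LHS]scalerA [RHS]scalerA mulrC.
  by apply: smul_in => //; exact: smul_in.
have mz : smul m (homothety z (P n0)) = homothety z (smul m (P n0)).
  apply/seteqP; split.
    apply: smul_min => [|b _ mb [p Pp ->]]; first exact/sH/submod_smul.
    by exists (b *: p); [exact: smul_in|rewrite [LHS]scalerA [RHS]scalerA mulrC].
  move=> _ [u mu ->].
  apply: (smul_min (submod_preimage (scale_linear (M := R^o) z) (submod_smul _ _)) _ mu).
  move=> b p mb Pp /=; have -> : z *: (b *: p) = b *: (z *: p).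
    by rewrite [LHS]scalerA [RHS]scalerA mulrC.
  by apply: smul_in => //; exists p.
have e : homothety (c ^+ n0) (homothety c mI) = homothety (c ^+ n0) (homothety z mI).
  rewrite !homothetyA -exprSr -mP zP // mz mP homothetyA mulrC //.
have rcn := @regular_exp _ _ _ n0 rc.
rewrite mCE; apply/seteqP; split=> v hv.
  have : homothety (c ^+ n0) (homothety c mI) (c ^+ n0 *: v) by exists v.
  by rewrite e => -[w hw /(regular_inj rcn) ->].
have : homothety (c ^+ n0) (homothety z mI) (c ^+ n0 *: v) by exists v.
by rewrite -e => -[w hw /(regular_inj rcn) ->].
Qed.

End Reduction.

(** If [m C] is contained in [c R] without being contained in [c m], some product [b v] is a
    unit times [c], and then [C = v R]. *)
Lemma smul_m_principal (c : R) : C c -> regular_on R^o c -> smul m C `<=` line (c : R^o) ->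
  exists v : R, [/\ C v, regular_on R^o v & smul m C = homothety v mI].
Proof using C1 R_noeth R_local.
move=> Cc rc mCc.
have ge v : C v -> homothety v mI `<=` smul m C.
  by move=> Cv _ [b mb ->]; rewrite /GRing.scale /= mulrC; exact: (smul_in (M := R^o) mb Cv).
have [sub|nsub] := pselect (smul m C `<=` homothety c mI).
  by exists c; split=> //; apply/seteqP; split=> //; exact: ge.
have [b [v [r [mb Cv mr bv]]]] : exists b v r : R, [/\ m b, C v, ~ m r & b * v = r * c].
  apply: contrapT => nex; apply: nsub.
  apply: smul_min => [|b v mb Cv]; first exact: (submod_homothety c sm).
  have [r bv] : line (c : R^o) (b *: v) by apply: mCc; exact: smul_in.
  exists r; last by rewrite bv /GRing.scale /= mulrC.
  by apply: contrapT => mr; apply: nex; exists b, v, r.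
have [s sr] := inverse_notin_m R_noeth R_local mr.
have cE : c = s * (b * v) by rewrite bv mulrA sr mul1r.
have rb : regular_on R^o b.
  move=> a ba; apply: rc; have {}ba : b * (a : R) = 0 := ba.
  have : c * (a : R) = 0; last by [].
  by rewrite cE -mulrA [b * v]mulrC -mulrA ba !mulr0.
exists v; split=> //.
  move=> a va; apply: rc; have {}va : v * (a : R) = 0 := va.
  have : c * (a : R) = 0; last by [].
  by rewrite cE -!mulrA va !mulr0.
apply/seteqP; split; last exact: ge.
apply: smul_min => [|b' u mb' Cu]; first exact: (submod_homothety v sm).
have [t bu] : line (c : R^o) (b *: u) by apply: mCc; exact: smul_in.
have uE : u = v * (s * t).
  apply: (regular_inj rb); rewrite bu.
  have : t * c = b * (v * (s * t)); last by [].
  by rewrite cE; ring.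
exists (b' * (s * t)); first by rewrite mulrC; exact: (submodZ _ sm).
by rewrite uE; have : b' * (v * (s * t)) = v * (b' * (s * t)) by ring.
Qed.
End CanonicalDegree.

(** * Almost Gorenstein rings *)

Section AlmostGorenstein.
Variables (R : comNzRingType) (m : set R).
Hypotheses (R_noeth : noetherian R) (R_local : local_ring m).
Hypothesis R_dim1 : krull_dim R^o = 1%N.
Variable C : set R^o.
Hypothesis C1 : type_one_ideal m C.

Let sm := submod_m R_local.

(** The sequence is [0 -> R -> W -> W / R w -> 0], where [w] corresponds to [z] in [C]. *)
Lemma almost_gorenstein_of_smul (W : lmodType R) (f : {linear W -> R^o}) (z : R) :
  canonical_module m W -> injective f -> range f = C -> C z -> regular_on R^o z ->
  smul m C `<=` line (z : R^o) -> almost_gorenstein m.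
Proof using R_noeth R_local R_dim1 C1.
move=> canW f_inj fC Cz rz mCz; have [sC _ _] := C1.
have [w fw] : exists w, f w = z by move: Cz; rewrite -fC => -[w _ <-]; exists w.
have sN := submod_line w; pose X : lmodType R := quotient_module sN.
pose g : {linear W -> X} := linear_of (quotient_map_linear sN).
have j_lin : linear (fun a : R^o => (a : R) *: w) by move=> a u v; rewrite scalerDl -scalerA.
have fN v : line w v <-> line (z : R^o) (f v).
  split=> [[r ->]|[r fv]]; first by exists r; rewrite linearZ fw.
  by exists r; apply: f_inj; rewrite linearZ fw.
have g_ker v : g v = 0 <-> line w v.
  by rewrite /= -[0](linear_fun0 (quotient_map_linear sN)) quotient_map_eq subr0.
have g_onto : range g = [set: X].
  by apply/seteqP; split=> // q _; exists (repr q); rewrite //= quotient_mapK.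
have zE : line (z : R^o) = homothety z [set: R^o].
  by apply/seteqP; split=> [_ [r ->]|_ [r _ ->]]; exists r; rewrite // /GRing.scale /= mulrC.
have zC : line (z : R^o) `<=` C by exact: line_min.
have fzC : finite_length (line (z : R^o)) C.
  apply: (finite_length_sub (submod_line _) (@subset_refl _ _) zC (@subsetT _ _)).
  by rewrite zE; exact: (finite_homothety R_noeth R_local R_dim1 rz).
have fN' : finite_length (line w) [set: W].
  apply/(@finite_length_transfer R W R^o f _ _ _ (line (z : R^o)) C) => //.
  - by move=> a u v; exact: linearP.
  - exact: submodT.
  - exact: submod_line.
  - by move=> v _; rewrite -fC; exists v.
  - by move=> v _; apply: iff_sym; exact: fN.
  - move=> c; rewrite -fC => -[v _ <-]; exists v => //.
    by rewrite subrr; exact: (submod0 (submod_line _)).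
have fX : finite_length [set (0 : X)] [set: X].
  by case: fN' => l lN; exists l; apply/(length_quotient sN g_onto g_ker).
have mX (b : R) (q : X) : m b -> b *: q = 0.
  move=> mb; have : [set: X] q by [].
  rewrite -g_onto => -[v _ <-]; rewrite -linearZ; apply/g_ker/fN.
  rewrite linearZ; apply: mCz; apply: smul_in => //.
  by rewrite -fC; exists v.
exists W, X, (linear_of j_lin), g; split=> //.
  split=> //.
    move=> a b /= /(congr1 f); rewrite !linearZ fw => e; apply: (regular_inj rz).
    have {}e : (a : R) * z = (b : R) * z := e.
    by have : z * (a : R) = z * (b : R); [rewrite mulrC e mulrC|].
  apply/seteqP; split=> [_ [a _ <-]|v /= gv]; first by apply/g_ker; exists a.
  by have /g_ker[r ->] := gv; exists (r : R^o).
by rewrite (nu_semisimple R_noeth R_local fX mX) (multiplicity_finite_length R_noeth R_local fX).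
Qed.

(** The cokernel [X] is killed by [m], so [m W] lies in [R w]. Embed [W] in [R] as an ideal; [w]
    becomes [z], and uniqueness of the canonical ideal carries [z] to the element [c1] of [C]. *)
Lemma smul_of_almost_gorenstein : almost_gorenstein m ->
  exists c : R, [/\ C c, regular_on R^o c & smul m C `<=` line (c : R^o)].
Proof using R_noeth R_local R_dim1 C1.
move=> [W [X [j [q [canW [j_inj ex q_onto] nuX]]]]].
have [g [z [g_inj rz gz C1']]] := canonical_over_ring R_noeth R_local R_dim1 canW j_inj.
have [sC _ _] := C1; have [sC' _ _] := C1'.
pose w := j (1 : R^o).
have jE (a : R) : j (a : R^o) = a *: w.
  by rewrite -linearZ /=; congr (j _); rewrite /GRing.scale /= mulr1.
have gw : g w = z.
  by apply: j_inj; rewrite [LHS]jE [RHS]jE gz.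
have q_ker v : q v = 0 <-> line w v.
  have -> : (q v = 0) = range j v by rewrite ex.
  by split=> [[a _ <-]|[r ->]]; [exists a; rewrite jE|exists (r : R^o) => //; rewrite jE].
have sN := submod_line w.
have gN v : line (z : R^o) (g v) <-> line w v.
  split=> [[r gv]|[r ->]]; last by exists r; rewrite linearZ gw.
  by exists r; apply: g_inj; rewrite linearZ gw.
have zC' : line (z : R^o) `<=` range g by apply: line_min => //; exists w.
have zE : line (z : R^o) = homothety z [set: R^o].
  by apply/seteqP; split=> [_ [r ->]|_ [r _ ->]]; exists r; rewrite // /GRing.scale /= mulrC.
have fzC : finite_length (line (z : R^o)) (range g).
  apply: (finite_length_sub (submod_line _) (@subset_refl _ _) zC' (@subsetT _ _)).
  by rewrite zE; exact: (finite_homothety R_noeth R_local R_dim1 rz).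
have fN : finite_length (line w) [set: W].
  apply/(@finite_length_transfer R W R^o g _ _ _ (line (z : R^o)) (range g)) => //.
  - by move=> a u v; exact: linearP.
  - exact: submodT.
  - exact: submod_line.
  - move=> c [v _ <-]; exists v => //.
    by rewrite subrr; exact: (submod0 (submod_line _)).
have fX : finite_length [set (0 : X)] [set: X].
  by case: fN => l lN; exists l; apply/(length_quotient sN q_onto q_ker).
have nuE : nu X = len [set (0 : X)] [set: X].
  by apply/eqP; rewrite -(Num.Theory.eqr_nat rat) nuX (multiplicity_finite_length R_noeth R_local fX).
have mX := semisimple_of_nu R_noeth R_local fX nuE.
have mC' (b : R) v : m b -> range g v -> exists r, b *: v = r *: (z : R^o).
  move=> mb [u _ <-]; rewrite -linearZ; apply/gN/q_ker.
  by rewrite linearZ /= mX.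
have [c [d [rc rd dC]]] := type_one_ideal_unique R_noeth R_local R_dim1 C1 C1'.
have [c1 Cc1 c1E] : homothety c C (d *: (z : R^o)).
  by rewrite -dC; exists (z : R^o) => //; apply: zC'; exact: line_self.
exists c1; split=> //.
  move=> a ca; apply: (regular_mul rd rz).
  have {}c1E : d * z = c * c1 := c1E; have {}ca : (c1 : R) * (a : R) = 0 := ca.
  by rewrite c1E; have : c * c1 * (a : R) = 0 by rewrite -mulrA ca mulr0.
apply: smul_min => [|b v mb Cv]; first exact: submod_line.
have [v' Cv' vE] : homothety d (range g) (c *: v) by rewrite dC; exists v.
have [r rE] := mC' b v' mb Cv'; exists r; apply: (regular_inj rc).
transitivity (b *: (c *: v)); first by rewrite [LHS]scalerA [RHS]scalerA mulrC.
rewrite vE; transitivity (d *: (b *: v')); first by rewrite [LHS]scalerA [RHS]scalerA mulrC.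
rewrite rE; transitivity (r *: (d *: (z : R^o))); first by rewrite [LHS]scalerA [RHS]scalerA mulrC.
by rewrite c1E [LHS]scalerA [RHS]scalerA mulrC.
Qed.

End AlmostGorenstein.

Theorem proposition4p3 (R : comNzRingType) (m C : set R)
    (R_CM : cohen_macaulay_local m)
    (R_dim1 : krull_dim R^o = 1%N)
    (R_inf : infinite_residue_field m)
    (C_canonical : canonical_ideal m C) :
  cdeg C = (cm_type m R^o)%:R - 1 <-> almost_gorenstein m.
Proof.
have [R_noeth R_local dR] := R_CM; rewrite R_dim1 in dR.
have [sC [W [canW [f [f_inj fC]]]]] := C_canonical.
have sm := submod_m R_local.
have [x mx rx] := depth1_regular dR.
have C1 : @type_one_ideal R m C.
  by rewrite -fC; exact: (canonical_ideal_type_one R_noeth R_local R_dim1 mx rx canW f_inj).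
have [_ [c0 [Cc0 mc0 rc0]] _] := C1.
have [z [n0 [Cz rz zP]]] := reduction R_noeth R_local R_inf sC R_dim1 Cc0 rc0 (ex_intro2 _ _ x mx rx).
have -> : cm_type m R^o = len (smul m (C : set R^o)) C.
  apply: (cm_type_socle sm _ dR mx rx).
    by case: canW => _ tW _; exact: cm_type1_resolution tW.
  by have [] := type_eq_generators R_noeth R_local R_dim1 C1 mx rx.
rewrite (cdeg_eq_type R_noeth R_local R_dim1 C1 Cz rz zP); split=> [mCE|].
  apply: (almost_gorenstein_of_smul R_noeth R_local R_dim1 C1 canW f_inj fC Cz rz).
  by rewrite mCE => _ [b _ ->]; exists b; rewrite /GRing.scale /= mulrC.
move=> /(smul_of_almost_gorenstein R_noeth R_local R_dim1 C1)[c1 [Cc1 rc1 mCc1]].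
have [c [Cc rc mCE]] := smul_m_principal R_noeth R_local C1 Cc1 rc1 mCc1.
exact: (smul_m_reduction R_noeth R_local R_dim1 C1 Cz rz zP Cc rc mCE).
Qed.
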